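(* Assume the standing setup below. Let $\rho_r>0$, $\gamma_1>0$, $\rho=\rho_r+\gamma_1$, and suppose conditions (C1), (C2), (C3) hold: (C1) $\|\mathcal{G}_{xm}(s)\|_{\mathcal{L}_1}b_{f,\Omega(\rho_r)}<\rho_r-\|\mathcal{H}_{xv}(s)\|_{\mathcal{L}_1}\|v\|_{\mathcal{L}_\infty}-\rho_\mathrm{in}$; (C2) $\|\mathcal{G}_{xm}(s)\|_{\mathcal{L}_1}L_{f,\Omega(\rho)}<1$; (C3) $\dfrac{\|\mathcal{H}_{xm}(s)\mathcal{C}(s)B^\dagger(sI_n-A_e)\|_{\mathcal{L}_1}}{1-\|\mathcal{G}_{xm}(s)\|_{\mathcal{L}_1}L_{f,\Omega(\rho)}}\gamma_0(T)<\gamma_1$. Then the adaptive closed-loop state $x$ and the nominal state $x_\mathrm{n}$ (same $v$, same $x_0$) satisfy $\|x-x_\mathrm{n}\|_{\mathcal{L}_\infty}\le\tilde\rho\triangleq\|\mathcal{G}_{xm}(s)\|_{\mathcal{L}_1}b_{f,\Omega(\rho_r)}+\gamma_1$, and $\|u_a\|_{\mathcal{L}_\infty}\le\rho_{u_a}\triangleq\|\mathcal{C}(s)\|_{\mathcal{L}_1}b_{f,\Omega(\rho_r)}+\gamma_2$, where $\gamma_2\triangleq\|\mathcal{C}(s)\|_{\mathcal{L}_1}L_{f,\Omega(\rho)}\gamma_1+\|\mathcal{C}(s)B^\dagger(sI_n-A_e)\|_{\mathcal{L}_1}\gamma_0(T)$.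
   Context: Notation: $\|\cdot\|_\infty$ vector/induced matrix $\infty$-norm; $\|x\|_{\mathcal{L}_\infty}=\sup_{t\ge0}\|x(t)\|_\infty$; $\Omega(\rho)=\{z:\|z\|_\infty\le\rho\}$; $\mathfrak{L}$ Laplace transform; $B^\dagger$ Moore–Penrose pseudo-inverse. For a stable proper transfer matrix $\mathcal{H}(s)$, $\|\mathcal{H}(s)\|_{\mathcal{L}_1}=\sup\{\|y\|_{\mathcal{L}_\infty}: y$ the zero-initial-state output for input $u$ with $\|u\|_{\mathcal{L}_\infty}\le1\}$. Standing setup: $A_m\in\mathbb{R}^{n\times n}$ Hurwitz, $B\in\mathbb{R}^{n\times m}$ full column rank, $B_v\in\mathbb{R}^{n\times m}$; $v$ bounded piecewise-continuous; $x_0\in\mathcal{X}_0$, $\mathcal{X}_0$ compact. Uncertainty $f:[0,\infty)\times\mathbb{R}^n\to\mathbb{R}^m$: for every compact $\mathcal{Z}$ there are constants with $|f_j(t,x)-f_j(\tau,z)|\le L_{f_j,\mathcal{Z}}\|x-z\|_\infty+l_{f_j,\mathcal{Z}}|t-\tau|$, $|f_j(t,x)|\le b_{f_j,\mathcal{Z}}$ for $x,z\in\mathcal{Z}$, $t,\tau\ge0$; $L_{f,\mathcal{Z}}=\max_jL_{f_j,\mathcal{Z}}$, $b_{f,\mathcal{Z}}=\max_jb_{f_j,\mathcal{Z}}$. Filter $\mathcal{C}(s)=\mathrm{diag}(k_f^j/(s+k_f^j))$, $k_f^j>0$. $\mathcal{H}_{xm}=(sI_n-A_m)^{-1}B$,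 $\mathcal{H}_{xv}=(sI_n-A_m)^{-1}B_v$, $\mathcal{G}_{xm}=\mathcal{H}_{xm}(I_m-\mathcal{C})$, $\rho_\mathrm{in}=\|s(sI_n-A_m)^{-1}\|_{\mathcal{L}_1}\max_{x_0\in\mathcal{X}_0}\|x_0\|_\infty$. Nominal system: $\dot x_\mathrm{n}=A_mx_\mathrm{n}+B_vv$, $x_\mathrm{n}(0)=x_0$. Adaptive system: $\dot x=A_mx+B_vv+B(u_a+f(t,x))$, $x(0)=x_0$, with $\mathcal{L}_1$ adaptive controller: Hurwitz $A_e$; $B^\perp\in\mathbb{R}^{n\times(n-m)}$ with $(B^\perp)^\top B=0$, $\mathrm{rank}[B\ B^\perp]=n$; predictor $\dot{\hat x}=A_mx+B_vv+B(u_a+\hat\sigma_1)+B^\perp\hat\sigma_2+A_e\tilde x$, $\hat x(0)=x_0$, $\tilde x=\hat x-x$; sample time $T>0$, $\Phi(T)=A_e^{-1}(e^{A_eT}-I_n)$; adaptive law $[\hat\sigma_1(t);\hat\sigma_2(t)]=-[B\ B^\perp]^{-1}\Phi^{-1}(T)e^{A_eT}\tilde x(iT)$ for $t\in[iT,(i+1)T)$, $i\in\mathbb{Z}_+$; control law $u_a(s)=-\mathcal{C}(s)\mathfrak{L}[\hat\sigma_1(t)]$. Solutions assumed to exist uniquely on $[0,\infty)$. $\bar\alpha_0(T)=\int_0^T\|e^{A_e(T-\tau)}B\|_\infty d\tau$, $\bar\alpha_1(T)=\max_{t\in[0,T]}\|e^{A_et}\|_\infty$, $\bar\alpha_2(T)=\max_{t\in[0,T]}\int_0^t\|e^{A_e(t-\tau)}\Phi^{-1}(T)e^{A_eT}\|_\infty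 d\tau$, $\gamma_0(T)=b_{f,\Omega(\rho)}\bar\alpha_0(T)(\bar\alpha_1(T)+\bar\alpha_2(T)+1)$. *)

(* Defs.v *)
From mathcomp Require Import all_boot all_order all_algebra.
From mathcomp Require Import all_classical all_reals all_analysis.
From mathcomp Require Import complex.
Set Implicit Arguments.
Unset Strict Implicit.
Unset Printing Implicit Defensive.
Import Order.TTheory GRing.Theory Num.Theory.
Import numFieldNormedType.Exports.
Local Open Scope classical_set_scope.
Local Open Scope ring_scope.

Section L1Defs.
Variable R : realType.

Definition vnorm {k : nat} (v : 'cV[R]_k) : R := \big[Num.max/0]_(i < k) `|v i 0|.

Definition mnorm {p q : nat} (A : 'M[R]_(p, q)) : R :=
  \big[Num.max/0]_(i < p) \sum_(j < q) `|A i j|.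

Definition Omega {k : nat} (r : R) : set 'cV[R]_k := [set z | vnorm z <= r].

Definition hurwitz {k : nat} (A : 'M[R]_k) : Prop :=
  forall z : R[i], root (map_poly (fun c : R => (c%:C)%C) (char_poly A)) z ->
    complex.Re z < 0.

Definition expmx {k : nat} (A : 'M[R]_k) : 'M[R]_k :=
  limn (series (fun j : nat => (j`!%:R)^-1 *: A ^+ j)).

(* Moore-Penrose pseudo-inverse of a full-column-rank matrix *)
Definition mppinv {p q : nat} (B : 'M[R]_(p, q)) : 'M[R]_(q, p) :=
  invmx (B^T *m B) *m B^T.

Definition vint {k : nat} (t : R) (F : R -> 'cV[R]_k) : 'cV[R]_k :=
  \col_i (\int[lebesgue_measure]_(s in `[0, t]) F s i 0).

Definition locint {k : nat} (F : R -> 'cV[R]_k) : Prop :=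
  forall t, 0 <= t -> forall i,
    lebesgue_measure.-integrable `[0, t] (fun s => (F s i 0)%:E).

(* x solves  x' = F, x(0) = x0  on [0, oo) (Caratheodory / integral form);
   F is the right-hand side already evaluated along x. *)
Definition ivp_sol {k : nat} (x0 : 'cV[R]_k) (F : R -> 'cV[R]_k)
  (x : R -> 'cV[R]_k) : Prop :=
  locint F /\ forall t, 0 <= t -> x t = x0 + vint t F.

Definition bounded_sig {k : nat} (v : R -> 'cV[R]_k) : Prop :=
  exists M : R, forall t, 0 <= t -> vnorm (v t) <= M.

Definition pw_continuous {k : nat} (v : R -> 'cV[R]_k) : Prop :=
  forall T, 0 < T -> exists s : seq R,
    (forall t, 0 < t <= T -> t \notin s -> {for t, continuous v}) /\
    (forall t, 0 <= t < T -> cvg (v x @[x --> t^'+])) /\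
    (forall t, 0 < t <= T -> cvg (v x @[x --> t^'-])).

Definition Linf {k : nat} (v : R -> 'cV[R]_k) : R :=
  fine (ereal_sup [set (vnorm (v t))%:E | t in [set t : R | 0 <= t]]).

(* transfer matrices: matrices over the field of rational functions R(s) *)
Definition tf := {fraction {poly R}}.
Definition cst (c : R) : tf := tofrac (c%:P).
Definition sF : tf := tofrac 'X.
Definition mxF {p q : nat} (A : 'M[R]_(p, q)) : 'M[tf]_(p, q) := map_mx cst A.
Definition resolvent {k : nat} (A : 'M[R]_k) : 'M[tf]_k :=
  invmx (sF%:M - mxF A).

(* y is the zero-initial-state output of the (proper) transfer matrix H
   driven by u: realized by some state-space realization of H. *)
Definition zs_output {p q : nat} (H : 'M[tf]_(p, q)) (u : R -> 'cV[R]_q)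
  (y : R -> 'cV[R]_p) : Prop :=
  exists (k : nat) (Ac : 'M[R]_k) (Bc : 'M[R]_(k, q)) (Cc : 'M[R]_(p, k))
         (Dc : 'M[R]_(p, q)) (z : R -> 'cV[R]_k),
    H = mxF Cc *m resolvent Ac *m mxF Bc + mxF Dc /\
    ivp_sol 0 (fun t => Ac *m z t + Bc *m u t) z /\
    (forall t, 0 <= t -> y t = Cc *m z t + Dc *m u t).

Definition L1norm {p q : nat} (H : 'M[tf]_(p, q)) : R :=
  fine (ereal_sup [set e | exists (u : R -> 'cV[R]_q) (y : R -> 'cV[R]_p) (t : R),
    [/\ 0 <= t, locint u, (forall s, 0 <= s -> vnorm (u s) <= 1),
        zs_output H u y & e = (vnorm (y t))%:E]]).

Definition Cfilt {m : nat} (kf : 'I_m -> R) : 'M[tf]_m :=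
  diag_mx (\row_j (cst (kf j) / (sF + cst (kf j)))).

Definition PhiT {k : nat} (Ae : 'M[R]_k) (T : R) : 'M[R]_k :=
  invmx Ae *m (expmx (T *: Ae) - 1%:M).

Definition alpha0 {k q : nat} (Ae : 'M[R]_k) (B : 'M[R]_(k, q)) (T : R) : R :=
  \int[lebesgue_measure]_(tau in `[0, T]) mnorm (expmx ((T - tau) *: Ae) *m B).

Definition alpha1 {k : nat} (Ae : 'M[R]_k) (T : R) : R :=
  sup [set mnorm (expmx (t *: Ae)) | t in [set t : R | 0 <= t <= T]].

Definition alpha2 {k : nat} (Ae : 'M[R]_k) (T : R) : R :=
  sup [set (\int[lebesgue_measure]_(tau in `[0, t])
              mnorm (expmx ((t - tau) *: Ae) *m invmx (PhiT Ae T) *m expmx (T *: Ae)))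
      | t in [set t : R | 0 <= t <= T]].

Definition f_lip {n m : nat} (f : R -> 'cV[R]_n -> 'cV[R]_m)
  (Z : set 'cV[R]_n) (L : R) : Prop :=
  exists l : R, forall (j : 'I_m) (x z : 'cV[R]_n) (t tau : R),
    0 <= t -> 0 <= tau -> Z x -> Z z ->
    `|f t x j 0 - f tau z j 0| <= L * vnorm (x - z) + l * `|t - tau|.

Definition f_bnd {n m : nat} (f : R -> 'cV[R]_n -> 'cV[R]_m)
  (Z : set 'cV[R]_n) (b : R) : Prop :=
  forall (j : 'I_m) (x : 'cV[R]_n) (t : R), 0 <= t -> Z x -> `|f t x j 0| <= b.

End L1Defs.

(* Main.v *)
Require Import Defs.
From mathcomp Require Import all_boot all_order all_algebra.
From mathcomp Require Import all_classical all_reals all_analysis.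
From mathcomp Require Import measurable_realfun complex ring lra.
Import Order.TTheory GRing.Theory Num.Theory.
Import numFieldNormedType.Exports.
Set Implicit Arguments.
Unset Strict Implicit.
Unset Printing Implicit Defensive.
Local Open Scope classical_set_scope.
Local Open Scope ring_scope.

(* The prediction error xt = xhat - x satisfies xt' = Ae xt + h - B f(t, x) with h constant
   on each sampling interval.  The adaptive law is dead-beat for the sampled value of xt,
   so |xt| <= gamma0 as long as |x| <= rho.  Since B^+ (s - Ae) xt = sigma1 - f, one gets
   x - xn = G f(x) - E xt and ua = - C f(x) - P xt, where G, E, P are the transfer matrices
   whose L1 norms occur in (C1)-(C3) and gamma2.  Instead of solving the reference system
   y = xn + G f(y), one compares x with its Picard iterates y_k: by (C1) they stay in
   Omega(rho_r) and within |G| b of xn, and by (C2), with q = |G| L < 1,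
   |x - y_k| <= q^k (2 rho) + |E| gamma0 / (1 - q), which is < gamma1 for large k by (C3).
   Hence |x| < rho strictly, and a continuity argument removes the assumption |x| <= rho.

   The L1 norm bounds outputs only if its supremum is finite.  The output of a transfer
   matrix does not depend on the realization, because the Markov parameters C A^j B are
   determined by it, and a Hurwitz matrix gives bounded states: along the roots of the
   characteristic polynomial each complex functional c z solves a damped scalar equation
   driven by c (A - l) z. *)

(** * Primitives of locally integrable functions *)

(** Two features of the definitions shape the proof. [zs_output] hides an arbitrary realization, so
    two outputs of one transfer matrix can be compared or subtracted only once independence of the
    realization is known. [L1norm] takes inputs bounded on all of [[0, oo)], while the closed-loop
    signals are controlled only up to the current time; causality reconciles the two by truncating
    the input. Solutions are meant in integral form with merely integrable right-hand sides, so
    calculus is done with primitives, and every input fed to a transfer matrix has to be shown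
    locally integrable, in particular [f(t, x(t))]. Picard iterates are preferred to an exact
    reference solution because the contraction constant [q] is available only on [Omega rho]: each
    iterate stays in [Omega rho_r] by its own estimate, no limit in a function space is formed, and
    the strictness of (C3) absorbs the geometric error left after finitely many steps. *)

Section Primitive.
Variable R : realType.
Local Notation mu := (@lebesgue_measure R).
Implicit Types (F G g h : R -> R) (a b t : R).

Definition locint1 g := forall t, 0 <= t -> mu.-integrable `[0, t] (EFin \o g).

(** Absolute continuity with derivative [g] almost everywhere: the form taken by the coordinates of
    an [ivp_sol] solution, which need not be differentiable at every point. *)
Definition primitive F g :=
  locint1 g /\ forall t, 0 <= t -> F t = F 0 + \int[mu]_(s in `[0, t]) g s.

Lemma locint1S g a b : 0 <= a -> locint1 g -> mu.-integrable `[a, b] (EFin \o g).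
Proof.
move=> a0 ig; have m0 : 0 <= Num.max a b by rewrite le_max a0.
apply: integrableS (ig _ m0) => //.
by apply: subset_itvScc; rewrite bnd_simp// le_max lexx orbT.
Qed.

Lemma primitive_int {F g} a b : primitive F g -> 0 <= a -> a <= b ->
  F b - F a = \int[mu]_(s in `[a, b]) g s.
Proof.
move=> [ig FE] a0 ab; rewrite (FE b) ?(le_trans a0)// (FE a)// opprD addrACA subrr add0r.
rewrite Rintegral_itvB ?bnd_simp//; last exact: (ig _ (le_trans a0 ab)).
rewrite Rintegral_itv_obnd_cbnd//.
by apply: (integrableS _ _ _ (locint1S b a0 ig)) => //; exact: subset_itv_oc_cc.
Qed.

(** A primitive is constrained only on [[0, oo)]; clamping the argument at [0] turns it into a
    function continuous on the whole line. *)
Lemma primitive_continuous {F g} : primitive F g ->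
  continuous (fun t => F (Num.max 0 t)).
Proof.
move=> [ig FE] t.
have E (s : R) : F (Num.max 0 s) = F 0 + \int[mu]_(r in `[0, s]) g r.
  case: (leP 0 s) => s0; first by rewrite FE.
  by rewrite set_itv_ge ?bnd_simp -?ltNge// Rintegral_set0 addr0.
(* Integrating the extension of [g] by zero from [-M] makes [t] an interior point, even when
   [t = 0]. *)
pose M := `|t| + 1; have M0 : 0 < M by rewrite ltr_pwDr.
have tM : -M < t < M by rewrite -ltr_norml /M ltrDl.
pose g0 := g \_ `[0, +oo[.
have capE (s : R) : `[-M, s] `&` `[0, +oo[ = `[0, s]%classic.
  apply/seteqP; split=> r /=; rewrite !in_itv/= ?andbT.
    by move=> [/andP[_ ->] ->].
  by move=> /andP[r0 ->]; rewrite r0 andbT; split=> //; lra.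
have ig0 : mu.-integrable `[-M, M] (EFin \o g0).
  rewrite -restrict_EFin; apply/integrable_restrict => //=.
  by rewrite capE; apply: ig; exact: ltW.
have MM : -M < M by lra.
have := parameterized_integral_continuous (ltW MM) ig0.
move/(continuous_within_itvP _ MM) => -[+ _ _] => /(_ t).
rewrite in_itv/= => /(_ tM) ct.
rewrite (_ : (fun _ => _) = (fun s => F 0 + parameterized_integral mu (-M) s g0)).
  by apply: cvgD; [exact: cvg_cst|exact: ct].
apply/funext => s; rewrite E; congr (_ + _).
by rewrite /parameterized_integral -Rintegral_mkcondr capE.
Qed.

Lemma continuous_bounded_itv F a b : continuous F ->
  exists M, forall s, a <= s <= b -> `|F s| <= M.
Proof.
move=> cF; have /compact_bounded[M [_ MP]] : compact (F @` `[a, b]).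
  by apply: continuous_compact; [exact: continuous_subspaceT|exact: segment_compact].
exists (M + 1) => s sab; apply: (MP (M + 1)); first by rewrite ltrDl.
by exists s => //=; rewrite in_itv.
Qed.

Lemma continuous_locint1 F : continuous F -> locint1 F.
Proof.
move=> cF t _; apply: continuous_compact_integrable; first exact: segment_compact.
exact: continuous_subspaceT.
Qed.

Lemma eq_locint1 g h : (forall t, 0 <= t -> g t = h t) -> locint1 g -> locint1 h.
Proof.
move=> gh ig t t0; apply: eq_integrable (ig t t0) => // s.
by rewrite inE/= in_itv/= => /andP[s0 _]; rewrite gh.
Qed.

Lemma primitive_bounded {F g} t : primitive F g ->
  exists M, forall s, 0 <= s <= t -> `|F s| <= M.
Proof.
move=> /primitive_continuous/continuous_bounded_itv-/(_ 0 t)[M MP].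
by exists M => s /[dup] /MP + /andP[s0 _]; rewrite max_r.
Qed.

Lemma primitive_locint1 {F g} : primitive F g -> locint1 F.
Proof.
move=> /primitive_continuous/continuous_locint1; apply: eq_locint1 => t t0.
by rewrite max_r.
Qed.

Lemma eq_primitive F G g h : (forall t, 0 <= t -> F t = G t) ->
  (forall t, 0 <= t -> g t = h t) -> primitive F g -> primitive G h.
Proof.
move=> FG gh [ig FE]; split; first exact: eq_locint1 ig.
move=> t t0; rewrite -!FG// FE//; congr (_ + _); apply: eq_Rintegral => s.
by rewrite inE/= in_itv/= => /andP[s0 _]; rewrite gh.
Qed.

Lemma locint1D g h : locint1 g -> locint1 h -> locint1 (fun t => g t + h t).
Proof. by move=> ig ih t t0; apply: integrableD (ig t t0) (ih t t0). Qed.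

Lemma locint1Z (c : R) g : locint1 g -> locint1 (fun t => c * g t).
Proof. by move=> ig t t0; apply: integrableZl (ig t t0). Qed.

Lemma locint1_cst (c : R) : locint1 (fun=> c).
Proof. by apply: continuous_locint1; exact: cst_continuous. Qed.

Lemma locint1_norm g : locint1 g -> locint1 (fun t => `|g t|).
Proof. by move=> ig t t0; exact: integrable_norm (ig t t0). Qed.

Lemma primitive_cst (c : R) : primitive (fun=> c) (fun=> 0).
Proof.
split; first exact: locint1_cst.
by move=> t t0; rewrite Rintegral_cst// mul0r addr0.
Qed.

Lemma primitiveD F G g h : primitive F g -> primitive G h ->
  primitive (fun t => F t + G t) (fun t => g t + h t).
Proof.
move=> [ig FE] [ih GE]; split; first exact: locint1D.
move=> t t0; rewrite FE// GE// RintegralD//; first ring.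
- exact: ig.
- exact: ih.
Qed.

Lemma primitiveZ (c : R) F g : primitive F g ->
  primitive (fun t => c * F t) (fun t => c * g t).
Proof.
move=> [ig FE]; split; first exact: locint1Z.
by move=> t t0; rewrite FE// RintegralZl ?mulrDr//; exact: ig.
Qed.

Lemma primitiveN F g : primitive F g -> primitive (fun t => - F t) (fun t => - g t).
Proof.
move=> /(primitiveZ (-1)); apply: eq_primitive => t t0; ring.
Qed.

Lemma primitiveB F G g h : primitive F g -> primitive G h ->
  primitive (fun t => F t - G t) (fun t => g t - h t).
Proof. by move=> Fg /primitiveN; exact: primitiveD. Qed.

Lemma primitive_sum (I : Type) (r : seq I) (F g : I -> R -> R) :
  (forall i, primitive (F i) (g i)) ->
  primitive (fun t => \sum_(i <- r) F i t) (fun t => \sum_(i <- r) g i t).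
Proof.
move=> Fg; elim: r => [|i r IH].
  by apply: eq_primitive (primitive_cst 0) => t t0; rewrite big_nil.
by apply: eq_primitive (primitiveD (Fg i) IH) => t t0; rewrite big_cons.
Qed.

Lemma primitive_le F G g h t : primitive F g -> primitive G h -> 0 <= t ->
  F 0 <= G 0 -> (forall s, 0 <= s <= t -> g s <= h s) -> F t <= G t.
Proof.
move=> [ig FE] [ih GE] t0 FG0 gh; rewrite FE// GE// lerD// le_Rintegral//.
- exact: ig.
- exact: ih.
Qed.

Lemma le_norm_Rintegral g h a b : mu.-integrable `[a, b] (EFin \o g) ->
  mu.-integrable `[a, b] (EFin \o h) ->
  (forall s, a <= s <= b -> `|g s| <= h s) ->
  `|\int[mu]_(s in `[a, b]) g s| <= \int[mu]_(s in `[a, b]) h s.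
Proof.
move=> ig ih gh; apply: le_trans (le_normr_Rintegral _ _) _ => //.
by apply: le_Rintegral => //; exact: integrable_norm.
Qed.

Lemma primitive_norm {g} : locint1 g ->
  primitive (fun t => \int[mu]_(s in `[0, t]) `|g s|) (fun t => `|g t|).
Proof.
move=> ig; split; first exact: locint1_norm.
by move=> t t0; rewrite set_itv1 Rintegral_set1 add0r.
Qed.

Lemma primitive_integral {g} : locint1 g ->
  primitive (fun t => \int[mu]_(s in `[0, t]) g s) g.
Proof.
by move=> ig; split => // t t0; rewrite set_itv1 Rintegral_set1 add0r.
Qed.

Lemma locint1M g G : locint1 g -> continuous G -> locint1 (fun t => g t * G t).
Proof.
move=> ig cG t t0.
have := @integrableMl _ _ _ mu `[0, t] _ (EFin \o g) G.
apply => //; first exact: ig.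
- by apply: measurable_funTS; exact: continuous_measurable_fun.
- have [M MP] := continuous_bounded_itv 0 t cG.
  exists M; split; rewrite ?num_real// => N MN s /=; rewrite in_itv/= => st.
  by rewrite (le_trans (MP s st))// ltW.
Qed.

Lemma primitive_norm_le F f G g a b : primitive F f -> primitive G g ->
  0 <= a -> a <= b -> (forall s, a <= s <= b -> `|f s| <= g s) ->
  `|F b - F a| <= G b - G a.
Proof.
move=> Ff Gg a0 ab fg; rewrite (primitive_int Ff)// (primitive_int Gg)//.
apply: le_norm_Rintegral => //; apply: locint1S => //.
- exact: (proj1 Ff).
- exact: (proj1 Gg).
Qed.

Lemma primitive_id (c : R) : primitive (fun t => c * t) (fun=> c).
Proof.
split; first exact: locint1_cst.
move=> t t0; rewrite mulr0 add0r Rintegral_cst//=.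
rewrite lebesgue_measure_itv/= lte_fin; move: t0; rewrite le_eqVlt.
by move=> /predU1P[<-|t0]; [rewrite ltxx mulr0|rewrite t0/= subr0].
Qed.

Lemma le_harmonic_eq0 (x C : R) : (forall n : nat, `|x| <= C / n.+1%:R) -> x = 0.
Proof.
move=> xC; apply/normr0_eq0/eqP; rewrite eq_le normr_ge0 andbT leNgt.
apply/negP => x0.
have C0 : 0 <= C by have := xC 0%N; rewrite divr1; apply: le_trans.
have /archi_boundP : 0 <= C / `|x| by rewrite divr_ge0.
set n := Num.bound _; rewrite ltr_pdivrMr// => Cn.
have := xC n; rewrite ler_pdivlMr// leNgt => /negP; apply.
by apply: (lt_le_trans Cn); rewrite mulrC ler_wpM2l// ler_nat.
Qed.

(** On [n + 1] equal steps each increment of [D] carries the factor [C t / (n + 1)] and the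
    increments of [N] telescope, so the total increment is at most [C t (N t - N 0) / (n + 1)] for
    every [n]. *)
Lemma subadditive_quadratic_cst (D N : R -> R) (C t : R) : 0 <= t ->
  (forall a b, 0 <= a -> a <= b -> b <= t ->
    `|D b - D a| <= C * (b - a) * (N b - N a)) -> D t = D 0.
Proof.
move=> t0 DN; apply/eqP; rewrite -subr_eq0; apply/eqP.
apply: (@le_harmonic_eq0 _ (C * t * (N t - N 0))) => n.
pose a (i : nat) := i%:R * (t / n.+1%:R).
have a0 : a 0%N = 0 by rewrite /a mul0r.
have an : a n.+1 = t by rewrite /a mulrC divfK.
rewrite -{1}an -{1}a0 -(@telescope_sumr _ 0%N n.+1 (D \o a))//.
apply: le_trans (ler_norm_sum _ _ _) _.
rewrite (_ : _ / _ = C * (t / n.+1%:R) * (N (a n.+1) - N (a 0%N))); last first.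
  by rewrite an a0; field.
rewrite -(@telescope_sumr _ 0%N n.+1 (N \o a))// mulr_sumr.
rewrite !big_nat; apply: ler_sum => i /andP[_ ni] /=.
have h0 : 0 <= t / n.+1%:R by rewrite divr_ge0.
have -> : t / n.+1%:R = a i.+1 - a i by rewrite /a -mulrBl -natrB// subSnn mul1r.
apply: DN; first by rewrite mulr_ge0.
- by rewrite ler_wpM2r// ler_nat.
- by rewrite -an ler_wpM2r// ler_nat.
Qed.

(* The defect [F G - \int (g G + F h)] has increments bounded by
   [2 M (b - a) \int_a^b |g|], so it vanishes along finer and finer partitions. *)
Lemma primitiveM F g G h : primitive F g -> primitive G h ->
  (forall t, exists M, forall s, 0 <= s <= t -> `|h s| <= M) ->
  primitive (fun t => F t * G t) (fun t => g t * G t + F t * h t).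
Proof.
move=> Fg Gh hb.
have ik : locint1 (fun t => g t * G t + F t * h t).
  apply: locint1D.
    apply: eq_locint1 (locint1M (proj1 Fg) (primitive_continuous Gh)) => t t0.
    by rewrite max_r.
  apply: eq_locint1 (locint1M (proj1 Gh) (primitive_continuous Fg)) => t t0.
  by rewrite max_r// mulrC.
split=> // t t0; have [M hM] := hb t.
have M0 : 0 <= M by rewrite (le_trans (normr_ge0 (h 0)))// hM// lexx.
have Kk := primitive_integral ik.
set K := (fun t => \int[mu]_(s in `[0, t]) _) in Kk.
have Nn := primitive_norm (proj1 Fg).
set N := (fun t => \int[mu]_(s in `[0, t]) _) in Nn.
suff : F t * G t - K t = F 0 * G 0 - K 0.
  by rewrite {2}/K set_itv1 Rintegral_set1 subr0 => <-; rewrite subrK.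
apply: (@subadditive_quadratic_cst (fun t => F t * G t - K t) N (2 * M)) => //.
move=> a b a0 ab bt.
(* Freezing [G] at [b] and [F] at [a] keeps the increment of the defect over [[a, b]], and the
   derivative becomes [g (G b - G s) + (F a - F s) h], which contains only differences across the
   interval. *)
have W : primitive (fun s => G b * F s + F a * G s - K s)
    (fun s => G b * g s + F a * h s - (g s * G s + F s * h s)).
  by apply: primitiveB Kk; apply: primitiveD; exact: primitiveZ.
have V : primitive (fun s => M * (b - a) * N s + (M * (N b - N a)) * s)
    (fun s => M * (b - a) * `|g s| + M * (N b - N a)).
  by apply: primitiveD (primitive_id _); exact: primitiveZ.
rewrite (_ : _ - _ = (G b * F b + F a * G b - K b) - (G b * F a + F a * G a - K a));
  last by ring.
apply: le_trans (primitive_norm_le W V a0 ab _) _; last first.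
  by rewrite le_eqVlt; apply/orP; left; apply/eqP; ring.
move=> s /andP[as_ sb].
have s0 := le_trans a0 as_.
rewrite (_ : _ - _ = g s * (G b - G s) + (F a - F s) * h s); last by ring.
apply: le_trans (ler_normD _ _) _; rewrite !normrM; apply: lerD.
  rewrite mulrC ler_wpM2r//.
  apply: le_trans (primitive_norm_le Gh (primitive_id M) s0 sb _) _.
    by move=> r /andP[sr rb]; apply: hM; rewrite (le_trans s0)// (le_trans rb).
  by rewrite -mulrBr ler_wpM2l// lerB.
rewrite mulrC; apply: ler_pM => //.
  by apply: hM; rewrite s0 (le_trans sb).
rewrite distrC.
apply: le_trans (primitive_norm_le Fg Nn a0 as_ _) _ => //.
rewrite lerB//.
have := primitive_norm_le (primitive_cst 0) Nn s0 sb.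
by rewrite subrr normr0 subr_ge0; apply => r _.
Qed.

Lemma primitive_derive F g : (forall t, is_derive t (1 : R) F (g t)) ->
  continuous g -> primitive F g.
Proof.
move=> dF cg; split; first exact: continuous_locint1.
have cF : continuous F.
  move=> t; apply: differentiable_continuous; apply/derivable1_diffP.
  exact: (@ex_derive _ _ _ _ _ _ _ (dF t)).
move=> t; rewrite le_eqVlt => /predU1P[<-|t0].
  by rewrite set_itv1 Rintegral_set1 addr0.
rewrite /Rintegral (@continuous_FTC2 _ g F 0 t)//=; first by rewrite addrCA subrr addr0.
- exact: continuous_subspaceT.
- split.
  + by move=> s _; apply: (@ex_derive _ _ _ _ _ _ _ (dF s)).
  + exact/cvg_at_right_filter/cF.
  + exact/cvg_at_left_filter/cF.
- by move=> s _; rewrite derive1E; apply: (@derive_val _ _ _ _ _ _ _ (dF s)).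
Qed.

End Primitive.

(** * Vector-valued initial value problems *)

Section VectorNorm.
Variable R : realType.

Lemma vnorm_ge0 k (v : 'cV[R]_k) : 0 <= vnorm v.
Proof. by rewrite /vnorm bigmax_idl le_max lexx. Qed.

Lemma vnorm_leP k (v : 'cV[R]_k) (c : R) :
  reflect (0 <= c /\ forall i, `|v i 0| <= c) (vnorm v <= c).
Proof.
apply: (iffP (bigmax_leP _ _ _ _)) => -[c0 H]; split=> // i *; exact: H.
Qed.

Lemma vnorm_coord k (v : 'cV[R]_k) i : `|v i 0| <= vnorm v.
Proof. by have /vnorm_leP[_] := lexx (vnorm v). Qed.

Lemma vnormD k (v w : 'cV[R]_k) : vnorm (v + w) <= vnorm v + vnorm w.
Proof.
apply/vnorm_leP; split=> [|i]; first by rewrite addr_ge0// vnorm_ge0.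
by rewrite mxE (le_trans (ler_normD _ _))// lerD// vnorm_coord.
Qed.

Lemma vnormN k (v : 'cV[R]_k) : vnorm (- v) = vnorm v.
Proof. by rewrite /vnorm; apply: eq_bigr => i _; rewrite mxE normrN. Qed.

Lemma vnormB k (v w : 'cV[R]_k) : vnorm (v - w) <= vnorm v + vnorm w.
Proof. by rewrite -(vnormN w) vnormD. Qed.

Lemma vnorm0 k : vnorm (0 : 'cV[R]_k) = 0.
Proof.
apply/eqP; rewrite eq_le vnorm_ge0 andbT; apply/vnorm_leP; split=> // i.
by rewrite mxE normr0.
Qed.

Lemma vnorm_eq0 k (v : 'cV[R]_k) : vnorm v <= 0 -> v = 0.
Proof.
move/vnorm_leP => [_ v0]; apply/colP => i; rewrite mxE; apply/normr0_eq0/eqP.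
by rewrite eq_le v0 normr_ge0.
Qed.

Lemma vnormZ k (c : R) (v : 'cV[R]_k) : vnorm (c *: v) <= `|c| * vnorm v.
Proof.
apply/vnorm_leP; split=> [|i]; first by rewrite mulr_ge0// vnorm_ge0.
by rewrite mxE normrM ler_wpM2l// vnorm_coord.
Qed.

Lemma vnorm_le_sum k (v : 'cV[R]_k) : vnorm v <= \sum_i `|v i 0|.
Proof.
apply/vnorm_leP; split=> [|i]; first by apply: sumr_ge0.
by rewrite (bigD1 i)//= lerDl sumr_ge0.
Qed.

Lemma mnorm_ge0 k q (A : 'M[R]_(k, q)) : 0 <= mnorm A.
Proof. by rewrite /mnorm bigmax_idl le_max lexx. Qed.

Lemma mnorm_row k q (A : 'M[R]_(k, q)) i : \sum_j `|A i j| <= mnorm A.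
Proof. exact: (le_bigmax _ (fun i => \sum_j `|A i j|)). Qed.

Lemma vnorm_mulmx k q (A : 'M[R]_(k, q)) v : vnorm (A *m v) <= mnorm A * vnorm v.
Proof.
apply/vnorm_leP; split=> [|i]; first by rewrite mulr_ge0 ?mnorm_ge0 ?vnorm_ge0.
rewrite mxE (le_trans (ler_norm_sum _ _ _))//.
apply: (@le_trans _ _ ((\sum_j `|A i j|) * vnorm v)); last first.
  by rewrite ler_wpM2r ?vnorm_ge0 ?mnorm_row.
by rewrite mulr_suml; apply: ler_sum => j _; rewrite normrM ler_wpM2l ?vnorm_coord.
Qed.

Lemma vnorm_expmx k (A : 'M[R]_k) v n : vnorm (A ^+ n *m v) <= mnorm A ^+ n * vnorm v.
Proof.
elim: n => [|n IH]; first by rewrite !expr0 mul1mx mul1r.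
rewrite exprS -mulmxA (le_trans (vnorm_mulmx _ _))// exprS -mulrA.
by rewrite ler_wpM2l ?mnorm_ge0.
Qed.

Lemma vnorm_col_mx k q (v : 'cV[R]_k) (w : 'cV[R]_q) (c : R) :
  vnorm v <= c -> vnorm w <= c -> vnorm (col_mx v w) <= c.
Proof.
move=> /vnorm_leP[c0 vc] /vnorm_leP[_ wc]; apply/vnorm_leP; split=> // i.
by case: (split_ordP i) => j ->; rewrite ?col_mxEu ?col_mxEd.
Qed.

End VectorNorm.

(** * Algebra of solutions in integral form; vanishing outputs *)

Section VectorPrimitive.
Variable R : realType.

Lemma ivpP k x0 (F x : R -> 'cV[R]_k) : ivp_sol x0 F x <->
  x 0 = x0 /\ forall i, primitive (fun t => x t i 0) (fun t => F t i 0).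
Proof.
split=> [[iF xE]|[x00 xF]].
  have x00 : x 0 = x0.
    by rewrite xE//; apply/colP => i; rewrite !mxE set_itv1 Rintegral_set1 addr0.
  split=> // i; split=> [t t0|t t0]; first exact: iF.
  by rewrite x00 xE// !mxE.
split=> [t t0 i|t t0]; first by have [+ _] := xF i; exact.
by apply/colP => i; have [_ ->//] := xF i; rewrite !mxE x00.
Qed.

Lemma ivp_at0 k x0 (F x : R -> 'cV[R]_k) : ivp_sol x0 F x -> x 0 = x0.
Proof. by move=> /ivpP[]. Qed.

Lemma ivp_coord k x0 (F x : R -> 'cV[R]_k) i : ivp_sol x0 F x ->
  primitive (fun t => x t i 0) (fun t => F t i 0).
Proof. by move=> /ivpP[]. Qed.

Lemma eq_ivp k x0 (F G x y : R -> 'cV[R]_k) : (forall t, 0 <= t -> F t = G t) ->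
  (forall t, 0 <= t -> x t = y t) -> ivp_sol x0 F x -> ivp_sol x0 G y.
Proof.
move=> FG xy /ivpP[x00 xF]; apply/ivpP; split; first by rewrite -xy.
by move=> i; apply: eq_primitive (xF i) => t t0; rewrite ?FG ?xy.
Qed.

Lemma ivp_mulmx k q (M : 'M[R]_(q, k)) x0 (F x : R -> 'cV[R]_k) :
  ivp_sol x0 F x -> ivp_sol (M *m x0) (fun t => M *m F t) (fun t => M *m x t).
Proof.
move=> /ivpP[x00 xF]; apply/ivpP; split; first by rewrite x00.
move=> i; have := primitive_sum (index_enum _) (fun j => primitiveZ (M i j) (xF j)).
by apply: eq_primitive => t t0; rewrite mxE.
Qed.

Lemma ivpD k x0 y0 (F G x y : R -> 'cV[R]_k) : ivp_sol x0 F x -> ivp_sol y0 G y ->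
  ivp_sol (x0 + y0) (fun t => F t + G t) (fun t => x t + y t).
Proof.
move=> /ivpP[x00 xF] /ivpP[y00 yG]; apply/ivpP; split; first by rewrite x00 y00.
by move=> i; apply: eq_primitive (primitiveD (xF i) (yG i)) => t t0; rewrite mxE.
Qed.

Lemma ivpN k x0 (F x : R -> 'cV[R]_k) : ivp_sol x0 F x ->
  ivp_sol (- x0) (fun t => - F t) (fun t => - x t).
Proof.
move=> /ivpP[x00 xF]; apply/ivpP; split; first by rewrite x00.
by move=> i; apply: eq_primitive (primitiveN (xF i)) => t t0; rewrite mxE.
Qed.

Lemma ivpB k x0 y0 (F G x y : R -> 'cV[R]_k) : ivp_sol x0 F x -> ivp_sol y0 G y ->
  ivp_sol (x0 - y0) (fun t => F t - G t) (fun t => x t - y t).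
Proof. by move=> xF /ivpN; exact: ivpD. Qed.

Lemma ivp_cst k (x0 : 'cV[R]_k) : ivp_sol x0 (fun=> 0) (fun=> x0).
Proof.
apply/ivpP; split=> // i.
by apply: eq_primitive (primitive_cst (x0 i 0)) => t t0 //; rewrite mxE.
Qed.

Lemma ivp_col_mx k q x0 y0 (F x : R -> 'cV[R]_k) (G y : R -> 'cV[R]_q) :
  ivp_sol x0 F x -> ivp_sol y0 G y ->
  ivp_sol (col_mx x0 y0) (fun t => col_mx (F t) (G t)) (fun t => col_mx (x t) (y t)).
Proof.
move=> /ivpP[x00 xF] /ivpP[y00 yG]; apply/ivpP; split; first by rewrite x00 y00.
move=> i; case: (split_ordP i) => j ->.
  by apply: eq_primitive (xF j) => t t0; rewrite col_mxEu.
by apply: eq_primitive (yG j) => t t0; rewrite col_mxEd.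
Qed.

Lemma ivp_usubmx k q x0 (F x : R -> 'cV[R]_(k + q)) : ivp_sol x0 F x ->
  ivp_sol (usubmx x0) (fun t => usubmx (F t)) (fun t => usubmx (x t)).
Proof.
move=> /ivpP[x00 xF]; apply/ivpP; split; first by rewrite x00.
by move=> i; apply: eq_primitive (xF (lshift q i)) => t t0; rewrite mxE.
Qed.

Lemma ivp_dsubmx k q x0 (F x : R -> 'cV[R]_(k + q)) : ivp_sol x0 F x ->
  ivp_sol (dsubmx x0) (fun t => dsubmx (F t)) (fun t => dsubmx (x t)).
Proof.
move=> /ivpP[x00 xF]; apply/ivpP; split; first by rewrite x00.
by move=> i; apply: eq_primitive (xF (rshift k i)) => t t0; rewrite mxE.
Qed.

Lemma locintP k (g : R -> 'cV[R]_k) : locint g <-> forall i, locint1 (fun t => g t i 0).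
Proof. by split=> [ig i t t0|ig t t0 i]; [exact: ig|exact: (ig i)]. Qed.

Lemma eq_locint k (g h : R -> 'cV[R]_k) : (forall t, 0 <= t -> g t = h t) ->
  locint g -> locint h.
Proof.
move=> gh /locintP ig; apply/locintP => i; apply: eq_locint1 (ig i) => t t0.
by rewrite gh.
Qed.

Lemma ivp_locint k x0 (F x : R -> 'cV[R]_k) : ivp_sol x0 F x -> locint x.
Proof. by move=> /ivpP[_ xF]; apply/locintP => i; exact: primitive_locint1. Qed.

Lemma ivp_integral k (g : R -> 'cV[R]_k) : locint g -> ivp_sol 0 g (fun t => vint t g).
Proof. by move=> ig; split=> // t t0; rewrite add0r. Qed.

Lemma locint_mulmx k q (M : 'M[R]_(q, k)) (g : R -> 'cV[R]_k) :
  locint g -> locint (fun t => M *m g t).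
Proof. by move=> /ivp_integral/(ivp_mulmx M)[]. Qed.

Lemma locintD k (g h : R -> 'cV[R]_k) : locint g -> locint h ->
  locint (fun t => g t + h t).
Proof. by move=> /ivp_integral gi /ivp_integral hi; have [] := ivpD gi hi. Qed.

Lemma locintN k (g : R -> 'cV[R]_k) : locint g -> locint (fun t => - g t).
Proof. by move=> /ivp_integral/ivpN[]. Qed.

Lemma locintB k (g h : R -> 'cV[R]_k) : locint g -> locint h ->
  locint (fun t => g t - h t).
Proof. by move=> ig /locintN; exact: locintD. Qed.

Lemma ivp_bounded k x0 (F x : R -> 'cV[R]_k) t : ivp_sol x0 F x ->
  exists2 M, 0 <= M & forall s, 0 <= s <= t -> vnorm (x s) <= M.
Proof.
move=> /ivpP[_ xF].
have /choice[M MP] i : exists M, forall s, 0 <= s <= t -> `|x s i 0| <= M.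
  exact: primitive_bounded.
exists (\sum_i `|M i|) => [|s st]; first exact: sumr_ge0.
apply: le_trans (vnorm_le_sum _) _; apply: ler_sum => i _.
exact: le_trans (MP i s st) (ler_norm _).
Qed.

Lemma primitive_monomial (c : R) n :
  primitive (fun t => c * (t ^+ n.+1 / n.+1`!%:R)) (fun t => c * (t ^+ n / n`!%:R)).
Proof.
apply: primitiveZ; apply: primitive_derive => [t|].
  have := is_deriveZ (n.+1`!%:R^-1) (is_deriveX n.+1 (is_derive_id t (1 : R))).
  rewrite (_ : _ \*: _ = fun t : R => t ^+ n.+1 / n.+1`!%:R); last first.
    by apply/funext => s /=; rewrite exprfctE /GRing.scale/= mulrC.
  move=> D; apply: (@is_derive_eq _ _ _ _ _ _ _ _ D).
  rewrite /GRing.scale/= mulr1 factS natrM; field.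
  by rewrite pnatr_eq0 -lt0n fact_gt0 gt_eqF // ltr_pwDl.
by move=> t; apply: cvgMl; exact: exprn_continuous.
Qed.

(* The iterated integrals of [C A^j z] are bounded by [K a^(j+N) s^N / N!]. *)
Lemma markov_output0 k q (A : 'M[R]_k) (C : 'M[R]_(q, k)) (g z : R -> 'cV[R]_k) t :
  ivp_sol 0 (fun s => A *m z s + g s) z ->
  (forall j s, 0 <= s <= t -> C *m A ^+ j *m g s = 0) ->
  forall s, 0 <= s <= t -> C *m z s = 0.
Proof.
move=> zA CAg s0 st0.
have [M M0 zM] := ivp_bounded t zA.
pose K := mnorm C * M; pose a := mnorm A.
have K0 : 0 <= K by rewrite mulr_ge0 ?mnorm_ge0.
have a0 : 0 <= a by exact: mnorm_ge0.
have bound N : forall j s, 0 <= s <= t ->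
    vnorm (C *m A ^+ j *m z s) <= K * a ^+ (j + N) * (s ^+ N / N`!%:R).
  elim: N => [|N IH] j s st.
    rewrite addn0 expr0 fact0 divr1 mulr1 -mulmxA.
    rewrite (le_trans (vnorm_mulmx _ _))// /K -mulrA ler_wpM2l ?mnorm_ge0//.
    rewrite (le_trans (vnorm_expmx _ _ _))// mulrC ler_wpM2r ?exprn_ge0//.
    exact: zM.
  have /andP[s0' st'] := st.
  have H0 : 0 <= K * a ^+ (j + N.+1) * (s ^+ N.+1 / N.+1`!%:R).
    by apply: mulr_ge0; [apply: mulr_ge0|apply: divr_ge0]; rewrite ?exprn_ge0.
  apply/vnorm_leP; split => // i.
  have := primitive_norm_le (ivp_coord i (ivp_mulmx (C *m A ^+ j) zA))
    (primitive_monomial (K * a ^+ (j + N.+1)) N) (lexx 0) s0'.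
  rewrite (ivp_at0 zA) mulmx0 [X in _ - X]mxE subr0 expr0n mul0r mulr0 subr0; apply.
  move=> r /andP[r0 rs].
  have rt : 0 <= r <= t by rewrite r0 (le_trans rs).
  rewrite mulmxDr CAg// addr0 mulmxA -(mulmxA C).
  rewrite (_ : A ^+ j *m A = A ^+ j.+1); last by rewrite exprSr.
  by apply: le_trans (vnorm_coord _ _) _; rewrite addnS -addSn; exact: IH.
apply: vnorm_eq0.
(* For [j = 0] the bounds are [K] times the terms of the exponential series at [a * s0], hence tend
   to [0]. *)
have cv : K * exp_coeff (a * s0) n @[n --> \oo] --> K * 0.
  by apply: cvgM; [exact: cvg_cst|exact: cvg_exp_coeff].
rewrite mulr0 in cv; rewrite -(cvg_lim _ cv)//.
apply: limr_ge; first by apply/cvg_ex; exists 0.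
near=> n; have := bound n 0%N s0 st0.
rewrite expr0 mulmx1 add0n => /le_trans; apply.
by rewrite /exp_coeff /= exprMn !mulrA.
Unshelve. all: by end_near. Qed.

Lemma ivp_homogeneous0 k (A : 'M[R]_k) (z : R -> 'cV[R]_k) t :
  ivp_sol 0 (fun s => A *m z s) z -> 0 <= t -> z t = 0.
Proof.
move=> zA t0; rewrite -[z t]mul1mx.
have zA' : ivp_sol 0 (fun s => A *m z s + 0) z.
  by apply: eq_ivp zA => // s s0; rewrite addr0.
apply: (markov_output0 (t := t) zA') => [j s st|]; last by rewrite t0 lexx.
by rewrite mulmx0.
Qed.

End VectorPrimitive.

(** * Matrix exponential and linear equations *)

Section MatrixExponential.
Variable R : realType.

Lemma mx_cvg (T : Type) (F : set_system T) (FF : Filter F) p q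
    (f : T -> 'M[R]_(p, q)) (M : 'M[R]_(p, q)) :
  (forall i j, f x i j @[x --> F] --> M i j) -> f x @[x --> F] --> M.
Proof.
move=> fM A [P PM PA]; rewrite /= nbhs_simpl.
have H : \forall x \near F, forall i j, P i j (f x i j).
  apply: filter_forall => i; apply: filter_forall => j; exact: (fM i j _ (PM i j)).
by apply: filterS H => x Px; apply: PA.
Qed.

Lemma cvg_sumr (T I : Type) (F : set_system T) (FF : Filter F) (r : seq I)
    (f : I -> T -> R) (a : I -> R) :
  (forall l, f l x @[x --> F] --> a l) ->
  \sum_(l <- r) f l x @[x --> F] --> \sum_(l <- r) a l.
Proof.
move=> fa; elim: r => [|l r IH].
  by under eq_fun do rewrite big_nil; rewrite big_nil; exact: cvg_cst.
under eq_fun do rewrite big_cons; rewrite big_cons; exact: cvgD (fa l) IH.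
Qed.

Lemma pseries_cvg_exp (c : nat -> R) (K a x : R) : 0 <= K -> 0 <= a ->
  (forall n, `|c n| <= K * (a ^+ n / n`!%:R)) -> cvgn (pseries c x).
Proof.
move=> K0 a0 cb; apply: normed_cvg.
apply: (@series_le_cvg _ _ (K *: exp_coeff (a * `|x|))) => [n|n|n|].
- exact: normr_ge0.
- by rewrite mulr_ge0// exp_coeff_ge0// mulr_ge0.
- rewrite /= normrM normrX
    (_ : (_ *: _) n = K * (a ^+ n / n`!%:R) * `|x| ^+ n).
    by rewrite ler_wpM2r// exprn_ge0.
  transitivity (K * exp_coeff (a * `|x|) n) => //; rewrite /exp_coeff/= exprMn.
  ring.
- apply: is_cvg_seriesZ; exact: is_cvg_series_exp_coeff.
Qed.

(** Formal differentiation keeps the shape of the bound and multiplies [K] by [a], so one estimate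
    yields the convergence of the three series that termwise differentiation requires. *)
Lemma pseries_diffs_exp (c : nat -> R) (K a : R) :
  (forall n, `|c n| <= K * (a ^+ n / n`!%:R)) ->
  forall n, `|pseries_diffs c n| <= (K * a) * (a ^+ n / n`!%:R).
Proof.
move=> cb n; rewrite /pseries_diffs normrM normr_nat.
apply: le_trans (ler_wpM2l _ (cb n.+1)) _ => //.
rewrite factS natrM le_eqVlt; apply/orP; left; apply/eqP; rewrite exprS; field.
by rewrite pnatr_eq0 -lt0n fact_gt0 gt_eqF // ltr_pwDl.
Qed.

Lemma pseries_derive_exp (c : nat -> R) (K a x : R) : 0 <= K -> 0 <= a ->
  (forall n, `|c n| <= K * (a ^+ n / n`!%:R)) ->
  is_derive x (1 : R) (fun x => limn (pseries c x)) (limn (pseries (pseries_diffs c) x)).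
Proof.
move=> K0 a0 cb.
have cb1 := pseries_diffs_exp cb; have cb2 := pseries_diffs_exp cb1.
apply: (@pseries_snd_diffs _ _ (`|x| + 1)).
- exact: pseries_cvg_exp cb.
- by apply: pseries_cvg_exp cb1; rewrite ?mulr_ge0.
- by apply: pseries_cvg_exp cb2; rewrite ?mulr_ge0.
- by rewrite [ltRHS]ger0_norm ?addr_ge0// ltrDl.
Qed.

Variable k : nat.
Implicit Types A : 'M[R]_k.

Definition expcoef A i j (n : nat) : R := n`!%:R^-1 * (A ^+ n) i j.

Lemma expcoef_bound A i j n :
  `|expcoef A i j n| <= 1 * (mnorm A ^+ n / n`!%:R).
Proof.
rewrite mul1r /expcoef normrM [X in X * _]ger0_norm ?invr_ge0// mulrC ler_wpM2r ?invr_ge0//.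
have -> : (A ^+ n) i j = (A ^+ n *m delta_mx j 0) i (0 : 'I_1).
  rewrite mxE (bigD1 j)//= mxE !eqxx mulr1 big1 ?addr0// => l lj.
  by rewrite mxE (negbTE lj) mulr0.
apply: le_trans (vnorm_coord _ _) _; apply: le_trans (vnorm_expmx _ _ _) _.
rewrite ler_piMr ?exprn_ge0 ?mnorm_ge0//; apply/vnorm_leP; split=> // l.
by rewrite mxE; case: (_ && _); rewrite ?normr1 ?normr0.
Qed.

Lemma scalemxX (t : R) A n : (t *: A) ^+ n = t ^+ n *: A ^+ n.
Proof.
elim: n => [|n IH]; first by rewrite !expr0 scale1r.
rewrite !exprS IH; transitivity ((t *: A) *m (t ^+ n *: A ^+ n)) => //.
by rewrite -scalemxAl -scalemxAr scalerA.
Qed.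

(** Trades the limit of matrices for a scalar power series in [t], which can be differentiated term
    by term. *)
Lemma expmxE A (t : R) i j : expmx (t *: A) i j = limn (pseries (expcoef A i j) t).
Proof.
rewrite /expmx.
set M := \matrix_(i, j) limn (pseries (expcoef A i j) t).
suff : series (fun n : nat => n`!%:R^-1 *: (t *: A) ^+ n) @ \oo --> M.
  by move/(cvg_lim (@norm_hausdorff _ _)) ->; rewrite mxE.
apply: (@mx_cvg nat \oo _ _ _ (series _)) => i' j'; rewrite /M mxE.
rewrite (_ : (fun x => _) = pseries (expcoef A i' j') t).
  exact: (pseries_cvg_exp ler01 (mnorm_ge0 A) (expcoef_bound A i' j')).
apply/funext => n; rewrite /pseries /series/= summxE; apply: eq_bigr => l _.
by rewrite !mxE scalemxX mxE /expcoef; ring.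
Qed.

Lemma expmx0 A : expmx (0 *: A) = 1%:M.
Proof.
apply/matrixP => i j; rewrite expmxE; apply: cvg_lim => //.
rewrite -cvg_shiftS (_ : [sequence _]_n = fun=> (1%:M : 'M[R]_k) i j).
  exact: cvg_cst.
apply/funext => n; rewrite /pseries /series/=.
rewrite big_nat_recl// big1 ?addr0; last by move=> l _; rewrite expr0n mulr0.
by rewrite /expcoef fact0 invr1 !expr0 mul1r mulr1.
Qed.

Lemma pseries_expcoef_suml (a : 'I_k -> R) (c : 'I_k -> nat -> R) (t : R) :
  (forall l, cvgn (pseries (c l) t)) ->
  limn (pseries (fun n => \sum_l a l * c l n) t) = \sum_l a l * limn (pseries (c l) t).
Proof.
move=> cc; apply: cvg_lim => //.
rewrite (_ : pseries _ _ = fun n => \sum_l a l * pseries (c l) t n).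
  by apply: cvg_sumr => l; apply: cvgM; [exact: cvg_cst|exact: cc].
apply/funext => n; rewrite /pseries /series/=.
under [RHS]eq_bigr do rewrite mulr_sumr.
rewrite exchange_big/=; apply: eq_bigr => m _; rewrite mulr_suml.
by apply: eq_bigr => l _; rewrite mulrA.
Qed.

Lemma pseries_expcoef_cvg A i j t : cvgn (pseries (expcoef A i j) t).
Proof. exact: (pseries_cvg_exp ler01 (mnorm_ge0 A) (expcoef_bound A i j)). Qed.

Lemma is_derive_expmx A i j t :
  is_derive t (1 : R) (fun t : R => expmx (t *: A) i j) ((A *m expmx (t *: A)) i j).
Proof.
under eq_fun do rewrite expmxE.
have D := pseries_derive_exp t ler01 (mnorm_ge0 A) (expcoef_bound A i j).
apply: (@is_derive_eq _ _ _ _ _ _ _ _ D).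
rewrite mxE; under eq_bigr do rewrite expmxE.
rewrite -pseries_expcoef_suml; last by move=> l; exact: pseries_expcoef_cvg.
congr (limn (pseries _ t)); apply/funext => n; rewrite /pseries_diffs /expcoef exprS.
rewrite (_ : A * A ^+ n = A *m A ^+ n)// mxE 2!mulr_sumr; apply: eq_bigr => l _.
rewrite factS natrM; field.
by rewrite pnatr_eq0 -lt0n fact_gt0 gt_eqF // ltr_pwDl.
Qed.

Lemma expmx_comm A t : expmx (t *: A) *m A = A *m expmx (t *: A).
Proof.
apply/matrixP => i j; rewrite !mxE.
under eq_bigr do rewrite mulrC expmxE.
under [RHS]eq_bigr do rewrite expmxE.
rewrite -!pseries_expcoef_suml; try by move=> l; exact: pseries_expcoef_cvg.
congr (limn (pseries _ t)); apply/funext => n; rewrite /expcoef.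
transitivity (n`!%:R^-1 * (A ^+ n * A) i j).
  by rewrite mxE mulr_sumr; apply: eq_bigr => l _; ring.
by rewrite -exprSr exprS mxE mulr_sumr; apply: eq_bigr => l _; ring.
Qed.

Lemma expmx_continuous A i j : continuous (fun t : R => expmx (t *: A) i j).
Proof.
move=> t; apply: differentiable_continuous; apply/derivable1_diffP.
exact: (@ex_derive _ _ _ _ _ _ _ (is_derive_expmx A i j t)).
Qed.

Lemma is_derive_expmxN A i j t : is_derive t (1 : R)
  (fun t => expmx ((- t) *: A) i j) (- (A *m expmx ((- t) *: A)) i j).
Proof.
have D := @is_derive1_comp _ (fun t : R => expmx (t *: A) i j) (fun t : R => - t)
  t _ _ (is_derive_expmx A i j (- t)) (is_deriveN (is_derive_id t (1 : R))).
by apply: (@is_derive_eq _ _ _ _ _ _ _ _ D); rewrite mulrN1.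
Qed.

Lemma expmxN_continuous A i j : continuous (fun t : R => expmx ((- t) *: A) i j).
Proof.
move=> t; apply: (@continuous_comp _ _ _ (fun t : R => - t)
  (fun t : R => expmx (t *: A) i j)); first exact: opp_continuous.
exact: expmx_continuous.
Qed.

Lemma expmxD A (s t : R) : expmx ((s + t) *: A) = expmx (s *: A) *m expmx (t *: A).
Proof.
(* The product is constant in [u]: its derivative cancels because [A] commutes with its exponential.
   The addition formula is the case [r = s + t], [u = - t]. *)
have key (r u : R) : expmx ((r + u) *: A) *m expmx ((- u) *: A) = expmx (r *: A).
  apply/matrixP => i j.
  transitivity ((expmx ((r + 0) *: A) *m expmx ((- 0) *: A)) i j); last first.
    by rewrite oppr0 expmx0 mulmx1 addr0.
  apply: (@is_derive_0_is_cst _ (fun u => (expmx ((r + u) *: A) *m expmx ((- u) *: A)) i j)).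
  move=> {}u.
  rewrite (_ : (fun _ => _) = \sum_(l < k)
    (fun u => expmx ((r + u) *: A) i l) * (fun u => expmx ((- u) *: A) l j)); last first.
    by apply/funext => v; rewrite mxE fct_sumE.
  have D1 l : is_derive u (1 : R) (fun u => expmx ((r + u) *: A) i l)
      ((A *m expmx ((r + u) *: A)) i l).
    have D := @is_derive1_comp _ (fun t => expmx (t *: A) i l) (fun t : R => r + t)
      u _ _ (is_derive_expmx A i l (r + u))
      (is_deriveD (is_derive_cst r u 1) (is_derive_id u (1 : R))).
    by apply: (@is_derive_eq _ _ _ _ _ _ _ _ D); rewrite add0r mulr1.
  have D := is_derive_sum (fun l => is_deriveM (D1 l) (is_derive_expmxN A l j u)).
  apply: (@is_derive_eq _ _ _ _ _ _ _ _ D).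
  rewrite big_split/= /GRing.scale/=; apply/eqP.
  under eq_bigr do rewrite mulrN.
  rewrite sumrN addrC subr_eq0; apply/eqP.
  transitivity ((expmx ((r + u) *: A) *m A *m expmx ((- u) *: A)) i j).
    by rewrite expmx_comm mxE; apply: eq_bigr => l _; rewrite mulrC.
  by rewrite -mulmxA mxE.
by rewrite -(key (s + t) (- t)) addrK opprK.
Qed.

Lemma expmxNK A (t : R) : expmx (t *: A) *m expmx ((- t) *: A) = 1%:M.
Proof. by rewrite -expmxD subrr expmx0. Qed.

End MatrixExponential.

(** * Variation of constants and existence for linear systems *)

Section LinearODE.
Variable R : realType.

Lemma ivp_mulmx_fun p k (P P' : R -> 'M[R]_(p, k)) z0 (F z : R -> 'cV[R]_k) :
  (forall i j t, is_derive t (1 : R) (fun t => P t i j) (P' t i j)) ->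
  (forall i j, continuous (fun t => P' t i j)) -> ivp_sol z0 F z ->
  ivp_sol (P 0 *m z0) (fun t => P t *m F t + P' t *m z t) (fun t => P t *m z t).
Proof.
move=> dP cP' /ivpP[z00 zF]; apply/ivpP; split; first by rewrite z00.
move=> i.
have PP l : primitive (fun t => z t l 0 * P t i l)
    (fun t => F t l 0 * P t i l + z t l 0 * P' t i l).
  apply: primitiveM => //; first by apply: primitive_derive.
  by move=> t; exact: continuous_bounded_itv.
apply: eq_primitive (primitive_sum (index_enum _) PP) => t t0; rewrite ?mxE.
  by apply: eq_bigr => l _; rewrite mulrC.
by rewrite -big_split; apply: eq_bigr => l _; congr (_ + _); rewrite mulrC.
Qed.

Lemma continuous_mulmx p q r (P : R -> 'M[R]_(p, q)) (Q : R -> 'M[R]_(q, r)) :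
  (forall i j, continuous (fun t => P t i j)) ->
  (forall i j, continuous (fun t => Q t i j)) ->
  forall i j, continuous (fun t => (P t *m Q t) i j).
Proof.
move=> cP cQ i j t; under eq_fun do rewrite mxE; rewrite ?mxE.
by apply: cvg_sumr => l; apply: cvgM; [exact: cP|exact: cQ].
Qed.

Lemma continuous_cstmx p q (M : 'M[R]_(p, q)) :
  forall i j, continuous (fun _ : R => M i j).
Proof. by move=> i j t; exact: cvg_cst. Qed.

(** The terms [e^(-tA) A z] and [- A e^(-tA) z] cancel by commutation, which leaves only the input
    under the integral. *)
Lemma variation_of_constants k (A : 'M[R]_k) z0 (g z : R -> 'cV[R]_k) :
  ivp_sol z0 (fun t => A *m z t + g t) z ->
  ivp_sol z0 (fun t => expmx ((- t) *: A) *m g t) (fun t => expmx ((- t) *: A) *m z t).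
Proof.
move=> zg; have := @ivp_mulmx_fun _ _ (fun t => expmx ((- t) *: A))
  (fun t => - (A *m expmx ((- t) *: A))) _ _ _ _ _ zg.
rewrite oppr0 expmx0 mul1mx => H.
apply: eq_ivp (H _ _) => // [t t0|i j t|i j t].
- by rewrite mulmxDr mulmxA expmx_comm mulNmx addrAC subrr add0r.
- by rewrite mxE; exact: is_derive_expmxN.
- rewrite (_ : (fun t => _) = fun t => - (A *m expmx ((- t) *: A)) i j); last first.
    by apply/funext => s; rewrite mxE.
  apply: cvgN; apply: (@continuous_mulmx _ _ _ (fun=> A) (fun t => expmx ((- t) *: A))).
    exact: continuous_cstmx.
  exact: expmxN_continuous.
Qed.

Lemma locint_mulmx_fun p k (P : R -> 'M[R]_(p, k)) (g : R -> 'cV[R]_k) :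
  (forall i j, continuous (fun t => P t i j)) -> locint g ->
  locint (fun t => P t *m g t).
Proof.
move=> cP /locintP ig; apply/locintP => i.
apply: (@eq_locint1 _ (fun t => \sum_l g t l 0 * P t i l)).
  by move=> t _; rewrite mxE; apply: eq_bigr => l _; rewrite mulrC.
apply: (proj1 (@primitive_sum R _ (index_enum 'I_k)
  (fun l t => \int[lebesgue_measure]_(s in `[0, t]) (g s l 0 * P s i l)) _ _)) => l.
by apply: primitive_integral; apply: locint1M.
Qed.

(** The solution is [e^(tA)] times the primitive of [e^(-tA) g]. It supplies the responses to
    truncated inputs and the filter and plant states of the Picard iterates. *)
Lemma linear_ivp_exists k (A : 'M[R]_k) (g : R -> 'cV[R]_k) : locint g ->
  exists z, ivp_sol 0 (fun t => A *m z t + g t) z.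
Proof.
move=> ig.
have iY : locint (fun t => expmx ((- t) *: A) *m g t).
  by apply: locint_mulmx_fun => // i j; exact: expmxN_continuous.
have := @ivp_mulmx_fun _ _ (fun t => expmx (t *: A)) (fun t => A *m expmx (t *: A))
  _ _ _ _ _ (ivp_integral iY).
rewrite mulmx0 => H; eexists; apply: eq_ivp (H _ _) => //.
- by move=> t t0; rewrite mulmxA expmxNK mul1mx addrC -mulmxA.
- by move=> i j t; exact: is_derive_expmx.
- apply: (@continuous_mulmx _ _ _ (fun=> A) (fun t => expmx (t *: A))).
    exact: continuous_cstmx.
  exact: expmx_continuous.
Qed.

End LinearODE.

(** * Transfer matrices and Markov parameters *)

Section TransferMatrix.
Variable R : realType.

Lemma mxFE p q (M : 'M[R]_(p, q)) :
  mxF M = map_mx (@tofrac {poly R}) (map_mx polyC M).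
Proof. by apply/matrixP => i j; rewrite !mxE. Qed.

Lemma mxF0 p q : mxF (0 : 'M[R]_(p, q)) = 0.
Proof. by rewrite mxFE !map_mx0. Qed.

Lemma mxF1 p : mxF (1%:M : 'M[R]_p) = 1%:M.
Proof. by rewrite mxFE !map_mx1. Qed.

Lemma mxFD p q (M N : 'M[R]_(p, q)) : mxF (M + N) = mxF M + mxF N.
Proof. by rewrite !mxFE !map_mxD. Qed.

Lemma mxFN p q (M : 'M[R]_(p, q)) : mxF (- M) = - mxF M.
Proof. by rewrite !mxFE !map_mxN. Qed.

Lemma mxFM p q r (M : 'M[R]_(p, q)) (N : 'M[R]_(q, r)) : mxF (M *m N) = mxF M *m mxF N.
Proof. by rewrite !mxFE !map_mxM. Qed.

Lemma mxF_col p q r (M : 'M[R]_(p, r)) (N : 'M[R]_(q, r)) :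
  mxF (col_mx M N) = col_mx (mxF M) (mxF N).
Proof. exact: map_col_mx. Qed.

Lemma mxF_row p q r (M : 'M[R]_(p, q)) (N : 'M[R]_(p, r)) :
  mxF (row_mx M N) = row_mx (mxF M) (mxF N).
Proof. exact: map_row_mx. Qed.

Lemma mxF_block p q r s (M : 'M[R]_(p, q)) (N : 'M[R]_(p, r)) (P : 'M[R]_(s, q))
    (Q : 'M[R]_(s, r)) :
  mxF (block_mx M N P Q) = block_mx (mxF M) (mxF N) (mxF P) (mxF Q).
Proof. exact: map_block_mx. Qed.

Lemma char_mxF k (A : 'M[R]_k) :
  (sF R)%:M - mxF A = map_mx (@tofrac {poly R}) (char_poly_mx A).
Proof. by rewrite mxFE /char_poly_mx map_mxB map_scalar_mx. Qed.

Lemma char_mxF_unit k (A : 'M[R]_k) : (sF R)%:M - mxF A \in unitmx.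
Proof.
rewrite char_mxF unitmxE unitfE det_map_mx tofrac_eq0.
exact: (monic_neq0 (char_poly_monic A)).
Qed.

(** Lets a realization be verified by multiplying out [sI - A] instead of computing an inverse. *)
Lemma resolvent_unique k q (A : 'M[R]_k) (X Y : 'M[tf R]_(k, q)) :
  ((sF R)%:M - mxF A) *m X = Y -> X = resolvent A *m Y.
Proof. by move=> <-; rewrite mulKmx// char_mxF_unit. Qed.

Lemma resolventE k (A : 'M[R]_k) : resolvent A =
  (tofrac (char_poly A))^-1 *: map_mx (@tofrac {poly R}) (\adj (char_poly_mx A)).
Proof.
rewrite /resolvent /invmx char_mxF_unit char_mxF det_map_mx.
by congr (_ *: _); rewrite map_mx_adj.
Qed.

Lemma map_tofrac_eq0 p q (M : 'M[{poly R}]_(p, q)) :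
  map_mx (@tofrac {poly R}) M = 0 -> M = 0.
Proof.
move/matrixP => M0; apply/matrixP => a b; have /eqP := M0 a b.
by rewrite !mxE tofrac_eq0 => /eqP.
Qed.

Lemma size_det_le n (M : 'M[{poly R}]_n) :
  (forall i j, (size (M i j) <= 2)%N) -> (size (\det M) <= n.+1)%N.
Proof.
move=> sM; apply: (leq_trans (size_sum _ _ _)); apply/bigmax_leqP => s _.
rewrite size_Msign (leq_trans (size_prod_leq _ _))//.
rewrite card_ord leq_subLR addnS ltnS addnn -muln2.
rewrite (leq_trans (leq_sum _ (fun i _ => sM i _)))//.
by rewrite sum_nat_const card_ord.
Qed.

(** The cofactors are determinants of order one less, with entries of degree at most one. *)
Lemma size_adj_char k (A : 'M[R]_k) i j : (size (\adj (char_poly_mx A) i j) <= k)%N.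
Proof.
case: k A i j => [A [] //|k A i j].
rewrite mxE /cofactor size_Msign; apply: size_det_le => a b; rewrite !mxE.
rewrite (leq_trans (size_polyD _ _))// size_polyN geq_max size_polyC.
by apply/andP; split; [case: (_ == _); rewrite ?size_polyX ?size_poly0|case: (_ == _)].
Qed.

Lemma size_const_mulmx p k q (C : 'M[R]_(p, k)) (N : 'M[{poly R}]_k) (B : 'M[R]_(k, q)) n :
  (forall i j, (size (N i j) <= n)%N) ->
  forall a b, (size ((map_mx polyC C *m N *m map_mx polyC B) a b) <= n)%N.
Proof.
move=> sN a b; rewrite mxE; apply: (leq_trans (size_sum _ _ _)).
apply/bigmax_leqP => j _; rewrite mxE mulrC mxE mul_polyC.
rewrite (leq_trans (size_scale_leq _ _))//; apply: (leq_trans (size_sum _ _ _)).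
apply/bigmax_leqP => i _; rewrite mxE mul_polyC.
by rewrite (leq_trans (size_scale_leq _ _)).
Qed.

(** [char_poly A] has degree exactly [k], so a nonzero entry of [D] would produce a term of degree
    [k] that the entries of [Q] are too small to cancel. *)
Lemma char_poly_combination0 k p q (A : 'M[R]_k) (Q : 'M[{poly R}]_(p, q)) (D : 'M[R]_(p, q)) :
  (forall a b, (size (Q a b) <= k)%N) ->
  Q + char_poly A *: map_mx polyC D = 0 -> D = 0 /\ Q = 0.
Proof.
move=> sQ QD.
have D0 : D = 0.
  apply/matrixP => a b; rewrite mxE; apply/eqP; apply/negPn/negP => dn0.
  have := sQ a b; move/matrixP/(_ a b): QD; rewrite !mxE => /eqP.
  rewrite addr_eq0 => /eqP ->; rewrite size_polyN mulrC mul_polyC size_scale//.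
  by rewrite size_char_poly ltnn.
by split=> //; move: QD; rewrite D0 map_mx0 scaler0 addr0.
Qed.

(* With [N = adj (X - A)] and [Q j = C A^j N B], the identity [(X - A) N = chi]
   gives [Q j.+1 = X Q j - chi C A^j B]; degrees force both terms to vanish. *)
Lemma transfer0_markov0 k p q (A : 'M[R]_k) (B : 'M[R]_(k, q)) (C : 'M[R]_(p, k))
    (D : 'M[R]_(p, q)) :
  mxF C *m resolvent A *m mxF B + mxF D = 0 ->
  D = 0 /\ forall j, C *m A ^+ j *m B = 0.
Proof.
pose N := \adj (char_poly_mx A); pose chi := char_poly A.
pose Q j := map_mx polyC (C *m A ^+ j) *m N *m map_mx polyC B.
have sQ j a b : (size (Q j a b) <= k)%N.
  by apply: size_const_mulmx => i i'; exact: size_adj_char.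
have chi0 : tofrac chi != 0.
  by rewrite tofrac_eq0 (monic_neq0 (char_poly_monic A)).
move=> H.
have H0 : Q 0%N + chi *: map_mx polyC D = 0.
  apply: map_tofrac_eq0; rewrite /Q expr0 mulmx1 map_mxD map_mxZ !map_mxM.
  transitivity (tofrac chi *: (mxF C *m resolvent A *m mxF B + mxF D)).
    rewrite -!mxFE scalerDr resolventE -/chi -/N -scalemxAr -scalemxAl.
    by rewrite scalerA divff// scale1r.
  by rewrite H scaler0.
have [D0 Q0] := char_poly_combination0 (sQ 0%N) H0.
have QS j : Q j.+1 + chi *: map_mx polyC (C *m A ^+ j *m B) = 'X *: Q j.
  have AN : 'X *: N = map_mx polyC A *m N + chi%:M.
    by rewrite /chi -mul_mx_adj -/N /char_poly_mx mulmxBl mul_scalar_mx addrC subrK.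
  rewrite /Q scalemxAl scalemxAr AN mulmxDr mulmxDl; congr (_ + _).
    by rewrite exprSr (_ : A ^+ j * A = A ^+ j *m A)// mulmxA map_mxM !mulmxA.
  by rewrite mul_mx_scalar -scalemxAl map_mxM.
have QA j : Q j = 0 /\ C *m A ^+ j *m B = 0.
  elim: j => [|j [Qj _]].
    split=> //; have := QS 0%N; rewrite Q0 scaler0 => /char_poly_combination0.
    by case=> // ; exact: sQ.
  have := QS j; rewrite Qj scaler0 => /char_poly_combination0 -[|_ Qj1]; first exact: sQ.
  split=> //; have := QS j.+1; rewrite Qj1 scaler0 => /char_poly_combination0.
  by case=> //; exact: sQ.
by split=> // j; have [] := QA j.
Qed.

(** The block-diagonal system with output row [C1], [- C2] realizes the difference of the two
    transfer matrices, which is zero. *)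
Lemma realization_unique k1 k2 p q
    (A1 : 'M[R]_k1) (B1 : 'M[R]_(k1, q)) (C1 : 'M[R]_(p, k1)) (D1 : 'M[R]_(p, q))
    (A2 : 'M[R]_k2) (B2 : 'M[R]_(k2, q)) (C2 : 'M[R]_(p, k2)) (D2 : 'M[R]_(p, q)) :
  mxF C1 *m resolvent A1 *m mxF B1 + mxF D1 = mxF C2 *m resolvent A2 *m mxF B2 + mxF D2 ->
  D1 = D2 /\ forall j, row_mx C1 (- C2) *m block_mx A1 0 0 A2 ^+ j *m col_mx B1 B2 = 0.
Proof.
move=> H.
have E : col_mx (resolvent A1 *m mxF B1) (resolvent A2 *m mxF B2) =
    resolvent (block_mx A1 0 0 A2) *m mxF (col_mx B1 B2).
  apply: resolvent_unique; rewrite mxF_block !mxF0 mxF_col scalar_mx_block.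
  rewrite opp_block_mx add_block_mx mul_block_col !oppr0 !addr0 !mul0mx add0r addr0.
  by rewrite !mulKVmx ?char_mxF_unit.
have := @transfer0_markov0 _ _ _ (block_mx A1 0 0 A2) (col_mx B1 B2)
  (row_mx C1 (- C2)) (D1 - D2).
rewrite -mulmxA -E mxF_row mul_row_col mxFD !mxFN mulNmx !mulmxA addrACA H -opprD subrr.
case=> // /eqP; rewrite subr_eq0 => /eqP D12 M; by split.
Qed.

End TransferMatrix.

(** * Hurwitz matrices *)

Section Stability.
Variable R : realType.

Lemma primitive_expR (a : R) : primitive (fun t => expR (a * t)) (fun t => a * expR (a * t)).
Proof.
apply: primitive_derive => [t|t].
  have D := @is_derive1_comp _ expR (fun t : R => a * t) t _ _
    (is_derive_expR (a * t)) (is_deriveZ a (is_derive_id t (1 : R))).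
  by apply: (@is_derive_eq _ _ _ _ _ _ _ _ D); rewrite /GRing.scale/= mulr1 mulrC.
apply: cvgMr; apply: (@continuous_comp _ _ _ (fun t : R => a * t) expR).
  exact: mulrl_continuous.
exact: continuous_expR.
Qed.

(* [V = p^2 + q^2] satisfies [V' <= - a V + 2 M^2 / a] with [a = - alpha]. *)
Lemma damped_rotation_bound (p q g1 g2 : R -> R) (alpha beta M : R) :
  alpha < 0 -> 0 <= M -> p 0 = 0 -> q 0 = 0 ->
  primitive p (fun t => alpha * p t - beta * q t + g1 t) ->
  primitive q (fun t => beta * p t + alpha * q t + g2 t) ->
  (forall t, 0 <= t -> `|g1 t| <= M) -> (forall t, 0 <= t -> `|g2 t| <= M) ->
  forall t, 0 <= t -> `|p t| <= 2 * M / - alpha /\ `|q t| <= 2 * M / - alpha.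
Proof.
move=> alpha0 M0 p0 q0 pp qp g1M g2M t t0.
pose a := - alpha; have a0 : 0 < a by rewrite oppr_gt0.
have pb s := primitive_bounded s pp; have qb s := primitive_bounded s qp.
have hb (c d : R) (g : R -> R) : (forall t, 0 <= t -> `|g t| <= M) ->
    forall s, exists N, forall r, 0 <= r <= s -> `|c * p r + d * q r + g r| <= N.
  move=> gM s; have [P pP] := pb s; have [Q qQ] := qb s.
  exists (`|c| * P + `|d| * Q + M) => r rs.
  rewrite (le_trans (ler_normD _ _))// lerD ?gM//; last by case/andP: rs.
  by rewrite (le_trans (ler_normD _ _))// !normrM lerD// ler_wpM2l// ?pP ?qQ.
have hp s : exists N, forall r, 0 <= r <= s -> `|alpha * p r - beta * q r + g1 r| <= N.
  by have [N HN] := hb alpha (- beta) g1 g1M s; exists N => r /HN; rewrite mulNr.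
have V := primitiveD (primitiveM pp pp hp) (primitiveM qp qp (hb beta alpha g2 g2M)).
have eb s : exists N, forall r, 0 <= r <= s -> `|a * expR (a * r)| <= N.
  have [N HN] := primitive_bounded s (primitive_expR a).
  by exists (`|a| * N) => r rs; rewrite normrM ler_wpM2l// HN.
(* The integrating factor [e^(at)] reduces the differential inequality to comparing the derivatives
   of [W] and [Z]. *)
have W := primitiveM V (primitive_expR a) eb.
have Z := primitiveZ (2 * M ^+ 2 / a ^+ 2) (primitive_expR a).
suff : (p t * p t + q t * q t) * expR (a * t) <= 2 * M ^+ 2 / a ^+ 2 * expR (a * t).
  rewrite ler_pM2r ?expR_gt0// => Vb.
  (* The hypothesis gives [sqrt 2 * M / a], rounded up to avoid the square root. *)
  have sqb (x : R) : x * x <= 2 * M ^+ 2 / a ^+ 2 -> `|x| <= 2 * M / a.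
    move=> xb; rewrite -(@ler_pXn2r _ 2)// ?nnegrE ?divr_ge0 ?mulr_ge0 ?(ltW a0)//.
    rewrite real_normK ?num_real// expr2 (le_trans xb)// expr_div_n.
    rewrite ler_pM2r ?invr_gt0 ?exprn_gt0//.
    by rewrite exprMn ler_wpM2r ?exprn_ge0// expr2; lra.
  by split; apply: sqb; apply: le_trans Vb; rewrite ?lerDl ?lerDr -expr2 sqr_ge0.
apply: (primitive_le W Z t0).
  rewrite p0 q0 !mul0r addr0 mul0r mulr0 expR0 mulr1.
  by rewrite divr_ge0 ?mulr_ge0 ?exprn_ge0 ?(ltW a0).
move=> s /andP[s0 st]; set E := expR (a * s).
  have E0 : 0 < E by exact: expR_gt0.
  have {}g1M := g1M s s0; have {}g2M := g2M s s0.
  (* Young's inequality. The damping of [V] is [2 a]: one half compensates the derivative of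
     [e^(at)], the other absorbs the two cross terms. *)
  have key (x g : R) : `|g| <= M -> 2 * (x * g) <= a * x ^+ 2 + M ^+ 2 / a.
    move=> gM; have : 0 <= (a * x - g) ^+ 2 / a by rewrite divr_ge0 ?sqr_ge0 ?ltW.
    have gM2 : g ^+ 2 / a <= M ^+ 2 / a.
      by rewrite ler_pM2r ?invr_gt0// -(real_normK (num_real g)) lerXn2r ?nnegrE.
    rewrite (_ : (a * x - g) ^+ 2 / a = a * x ^+ 2 - 2 * (x * g) + g ^+ 2 / a); last first.
      by field; rewrite gt_eqF.
    lra.
  have k1 := key (p s) (g1 s) g1M; have k2 := key (q s) (g2 s) g2M.
  rewrite [leRHS](_ : _ = (2 * (M ^+ 2 / a)) * E); last by field; rewrite gt_eqF.
  rewrite [leLHS](_ : _ = (2 * (p s * g1 s) + 2 * (q s * g2 s)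
     - a * (p s ^+ 2 + q s ^+ 2)) * E); last by rewrite /a; ring.
  by rewrite ler_pM2r//; lra.
Qed.

(** Stability expressed through solutions rather than eigenvalues: in this form it passes to
    cascades and excludes kernel vectors of [A] and of [e^(TA) - 1]. *)
Definition bibo_mx k (A : 'M[R]_k) := exists2 M : R, 0 <= M &
  forall (c : R) (g z : R -> 'cV[R]_k), 0 <= c -> (forall t, 0 <= t -> vnorm (g t) <= c) ->
    ivp_sol 0 (fun t => A *m z t + g t) z -> forall t, 0 <= t -> vnorm (z t) <= M * c.

Local Notation ReM c := (map_mx (@complex.Re R) c).
Local Notation ImM c := (map_mx (@complex.Im R) c).

Lemma Re_sum (I : Type) (r : seq I) (F : I -> R[i]) :
  complex.Re (\sum_(i <- r) F i) = \sum_(i <- r) complex.Re (F i).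
Proof. by apply: (big_morph (@complex.Re R)) => // -[a b] [c d]. Qed.

Lemma Im_sum (I : Type) (r : seq I) (F : I -> R[i]) :
  complex.Im (\sum_(i <- r) F i) = \sum_(i <- r) complex.Im (F i).
Proof. by apply: (big_morph (@complex.Im R)) => // -[a b] [c d]. Qed.

Lemma ReM_mulmx k (c : 'rV[R[i]]_k) (A : 'M[R]_k) :
  ReM (c *m map_mx (real_complex R) A) = ReM c *m A.
Proof.
apply/matrixP => i j; rewrite !mxE Re_sum; apply: eq_bigr => l _; rewrite !mxE.
by case: (c i l) => a b /=; rewrite mulr0 subr0.
Qed.

Lemma ImM_mulmx k (c : 'rV[R[i]]_k) (A : 'M[R]_k) :
  ImM (c *m map_mx (real_complex R) A) = ImM c *m A.
Proof.
apply/matrixP => i j; rewrite !mxE Im_sum; apply: eq_bigr => l _; rewrite !mxE.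
by case: (c i l) => a b /=; rewrite mulr0 add0r mulrC.
Qed.

(* [c z] solves a scalar equation with eigenvalue [l] driven by [c (A - l) z], which is
   bounded by induction on the list of roots. *)
Lemma annihilated_functional_bound k (A : 'M[R]_k) (s : seq R[i]) :
  (forall l, l \in s -> complex.Re l < 0) ->
  forall c : 'rV[R[i]]_k,
  c *m \prod_(l <- s) (map_mx (real_complex R) A - l%:M) = 0 ->
  exists2 M : R, 0 <= M & forall b (g z : R -> 'cV[R]_k), 0 <= b ->
    (forall t, 0 <= t -> vnorm (g t) <= b) -> ivp_sol 0 (fun t => A *m z t + g t) z ->
    forall t, 0 <= t ->
      `|(ReM c *m z t) 0 0| <= M * b /\ `|(ImM c *m z t) 0 0| <= M * b.
Proof.
elim: s => [|l s IH] sneg c.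
  rewrite big_nil mulmx1 => ->; exists 0 => // b g z _ _ _ t _.
  have -> : ReM (0 : 'rV[R[i]]_k) = 0 by apply/matrixP => i j; rewrite !mxE.
  have -> : ImM (0 : 'rV[R[i]]_k) = 0 by apply/matrixP => i j; rewrite !mxE.
  by rewrite mul0mx mxE normr0 mul0r.
rewrite big_cons => cs.
pose c' := c *m (map_mx (real_complex R) A - l%:M).
have [] := IH _ c'.
- by move=> x xs; apply: sneg; rewrite inE xs orbT.
- by rewrite -mulmxA.
move=> M' M'0 HM'.
have l0 : complex.Re l < 0 by apply: sneg; rewrite inE eqxx.
pose K := mnorm (ReM c) + mnorm (ImM c).
have K0 : 0 <= K by rewrite addr_ge0// mnorm_ge0.
have cA : c *m map_mx (real_complex R) A = l *: c + c'.
  by rewrite /c' mulmxBr mul_mx_scalar addrC subrK.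
(* Real and imaginary parts of [c A = l c + c']: the pair [Re c z], [Im c z] is a damped rotation
   with coefficients [Re l] and [Im l], driven by [c' z + c g]. *)
have ReA : ReM c *m A = complex.Re l *: ReM c - complex.Im l *: ImM c + ReM c'.
  rewrite -ReM_mulmx cA; move: c' {cs cA HM'} => d; apply/matrixP => i j; rewrite !mxE.
  by case: (l) (c i j) (d i j) => a b [e f] [h h'].
have ImA : ImM c *m A = complex.Im l *: ReM c + complex.Re l *: ImM c + ImM c'.
  rewrite -ImM_mulmx cA; move: c' {cs cA HM' ReA} => d; apply/matrixP => i j; rewrite !mxE.
  by case: (l) (c i j) (d i j) => a b [e f] [h h'] /=; congr (_ + _); rewrite addrC.
have addE (X Y : 'M[R]_1) : (X + Y) 0 0 = X 0 0 + Y 0 0 by rewrite mxE.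
have oppE (X : 'M[R]_1) : (- X) 0 0 = - X 0 0 by rewrite mxE.
have scaleE (a : R) (X : 'M[R]_1) : (a *: X) 0 0 = a * X 0 0 by rewrite mxE.
exists (2 * (M' + K) / - complex.Re l).
  by apply: divr_ge0; [apply: mulr_ge0 => //; exact: addr_ge0|rewrite oppr_ge0 ltW].
move=> b g z b0 gb zA t t0.
have {}HM' := HM' b g z b0 gb zA.
have := @damped_rotation_bound (fun t => (ReM c *m z t) 0 0) (fun t => (ImM c *m z t) 0 0)
  (fun t => (ReM c' *m z t) 0 0 + (ReM c *m g t) 0 0)
  (fun t => (ImM c' *m z t) 0 0 + (ImM c *m g t) 0 0)
  (complex.Re l) (complex.Im l) ((M' + K) * b) l0.
have fb (d : 'rV[R]_k) r : mnorm d <= K -> 0 <= r -> `|(d *m g r) 0 0| <= K * b.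
  move=> dK r0; apply: le_trans (vnorm_coord _ _) _.
  apply: le_trans (vnorm_mulmx _ _) _; apply: ler_pM => //; rewrite ?mnorm_ge0 ?vnorm_ge0//.
  exact: gb.
rewrite (_ : 2 * ((M' + K) * b) / - complex.Re l =
  2 * (M' + K) / - complex.Re l * b); last by ring.
apply => //.
- by rewrite mulr_ge0// addr_ge0.
- by rewrite (ivp_at0 zA) mulmx0 mxE.
- by rewrite (ivp_at0 zA) mulmx0 mxE.
- apply: eq_primitive (ivp_coord 0 (ivp_mulmx (ReM c) zA)) => // r r0.
  rewrite mulmxDr mulmxA ReA !mulmxDl mulNmx -!scalemxAl.
  by rewrite !addE oppE !scaleE addrA.
- apply: eq_primitive (ivp_coord 0 (ivp_mulmx (ImM c) zA)) => // r r0.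
  by rewrite mulmxDr mulmxA ImA !mulmxDl -!scalemxAl !addE !scaleE addrA.
- move=> r r0; rewrite mulrDl (le_trans (ler_normD _ _))// lerD//.
    by have [] := HM' r r0.
  by apply: fb => //; rewrite lerDl mnorm_ge0.
- move=> r r0; rewrite mulrDl (le_trans (ler_normD _ _))// lerD//.
    by have [] := HM' r r0.
  by apply: fb => //; rewrite lerDr mnorm_ge0.
Qed.

Lemma hurwitz_bibo k (A : 'M[R]_k) : hurwitz A -> bibo_mx A.
Proof.
case: k A => [A _|k A hA].
  exists 0 => // c g z _ _ _ t _; rewrite mul0r.
  by apply/vnorm_leP; split=> // -[].
pose AC := map_mx (real_complex R) A.
have [r rP] := closed_field_poly_normal (char_poly AC).
rewrite (monicP (char_poly_monic AC)) scale1r in rP.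
have rneg l : l \in r -> complex.Re l < 0.
  move=> lr; apply: hA.
  rewrite (_ : map_poly _ _ = char_poly AC); last exact: map_char_poly.
  by rewrite rP root_prod_XsubC.
(* By Cayley-Hamilton the full product of factors annihilates every functional, in particular each
   coordinate. *)
have CH : \prod_(l <- r) (AC - l%:M) = 0.
  rewrite -(Cayley_Hamilton AC) rP rmorph_prod; apply: eq_bigr => l _.
  by rewrite rmorphB /= horner_mx_X horner_mx_C.
have /choice[M MP] i : exists M : R, 0 <= M /\ forall b (g z : R -> 'cV[R]_k.+1), 0 <= b ->
    (forall t, 0 <= t -> vnorm (g t) <= b) -> ivp_sol 0 (fun t => A *m z t + g t) z ->
    forall t, 0 <= t -> `|z t i 0| <= M * b.
  have c0 : delta_mx 0 i *m \prod_(l <- r) (AC - l%:M) = 0 :> 'rV_k.+1.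
    by rewrite CH mulmx0.
  have [M M0 HM] := annihilated_functional_bound rneg c0.
  exists M; split=> // b g z b0 gb zA t t0; have [+ _] := HM b g z b0 gb zA t t0.
  rewrite mxE (bigD1 i)//= big1 ?addr0; last first.
    by move=> j ji; rewrite !mxE (negbTE ji) /= mul0r.
  by rewrite !mxE !eqxx/= mul1r.
exists (\sum_i M i) => [|b g z b0 gb zA t t0].
  by apply: sumr_ge0 => i _; have [] := MP i.
apply: le_trans (vnorm_le_sum _) _; rewrite mulr_suml; apply: ler_sum => i _.
by have [_] := MP i; apply; eassumption.
Qed.

(** The lower block evolves independently of the upper one and then acts on it as an additional
    bounded input. This covers the plant in series with the filter. *)
Lemma bibo_cascade k1 k2 (A1 : 'M[R]_k1) (A2 : 'M[R]_k2) (A12 : 'M[R]_(k1, k2)) :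
  bibo_mx A1 -> bibo_mx A2 -> bibo_mx (block_mx A1 A12 0 A2).
Proof.
move=> [M1 M10 H1] [M2 M20 H2].
pose K := M2 + M1 * (mnorm A12 * M2 + 1).
have A0 := mnorm_ge0 A12.
exists K => [|c g z c0 gc zA t t0].
  by rewrite addr_ge0 ?mulr_ge0 ?addr_ge0 ?mulr_ge0.
have gub s : 0 <= s -> vnorm (usubmx (g s)) <= c.
  move=> s0; apply/vnorm_leP; split=> // i; rewrite mxE.
  exact: le_trans (vnorm_coord _ _) (gc s s0).
have gdb s : 0 <= s -> vnorm (dsubmx (g s)) <= c.
  move=> s0; apply/vnorm_leP; split=> // i; rewrite mxE.
  exact: le_trans (vnorm_coord _ _) (gc s s0).
have z2 : ivp_sol 0 (fun t => A2 *m dsubmx (z t) + dsubmx (g t)) (fun t => dsubmx (z t)).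
  have := ivp_dsubmx zA; rewrite linear0; apply: eq_ivp => // s s0.
  rewrite linearD /= -{1}(vsubmxK (z s)) mul_block_col col_mxKd mul0mx add0r.
  by [].
have z1 : ivp_sol 0 (fun t => A1 *m usubmx (z t) + (A12 *m dsubmx (z t) + usubmx (g t)))
    (fun t => usubmx (z t)).
  have := ivp_usubmx zA; rewrite linear0; apply: eq_ivp => // s s0.
  by rewrite linearD /= -{1}(vsubmxK (z s)) mul_block_col col_mxKu addrA.
have b2 := H2 c _ _ c0 gdb z2.
have c10 : 0 <= (mnorm A12 * M2 + 1) * c.
  by rewrite mulr_ge0 ?addr_ge0 ?mulr_ge0.
have b1 := H1 ((mnorm A12 * M2 + 1) * c) _ _ c10 _ z1.
rewrite -(vsubmxK (z t)); apply: vnorm_col_mx.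
  apply: le_trans (b1 _ t t0) _.
    move=> s s0; rewrite (le_trans (vnormD _ _))// mulrDl mul1r lerD ?gub//.
    rewrite (le_trans (vnorm_mulmx _ _))// -mulrA ler_wpM2l//; exact: b2.
  by rewrite mulrA ler_wpM2r// lerDr.
apply: le_trans (b2 t t0) _; rewrite ler_wpM2r// lerDl.
by rewrite mulr_ge0 ?addr_ge0 ?mulr_ge0.
Qed.

(** Each coordinate is a scalar damped equation, that is, a damped rotation with zero angular speed
    and zero second component. *)
Lemma bibo_diag k (d : 'rV[R]_k) : (forall i, 0 < d 0 i) -> bibo_mx (- diag_mx d).
Proof.
move=> d0.
exists (\sum_i (2 / d 0 i)) => [|c g z c0 gc zA t t0].
  by apply: sumr_ge0 => i _; rewrite divr_ge0// ltW.
apply: le_trans (vnorm_le_sum _) _; rewrite mulr_suml; apply: ler_sum => i _.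
have := @damped_rotation_bound (fun t => z t i 0) (fun=> 0) (fun t => g t i 0) (fun=> 0)
  (- d 0 i) 0 c.
rewrite oppr_lt0 opprK => H.
suff [+ _] : `|z t i 0| <= 2 * c / d 0 i /\ `|0 : R| <= 2 * c / d 0 i.
  by rewrite mulrAC.
apply: H => //.
- by rewrite (ivp_at0 zA) mxE.
- apply: eq_primitive (ivp_coord i zA) => // s s0.
  by rewrite mxE mulNmx mxE mul_diag_mx mxE mul0r subr0 mulNr.
- by apply: eq_primitive (primitive_cst 0) => // s s0; rewrite mul0r mulr0 !addr0.
- by move=> s s0; exact: le_trans (vnorm_coord _ _) (gc s s0).
- by move=> s s0; rewrite normr0.
Qed.

End Stability.

(** * The L1 norm *)

Section TransferOutput.
Variable R : realType.
Variables p q : nat.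
Implicit Types (H : 'M[tf R]_(p, q)) (u : R -> 'cV[R]_q) (y : R -> 'cV[R]_p).

(** The two realizations may differ, so both are run side by side with output [C1 z1 - C2 z2]. The
    joint Markov parameters vanish, hence so does this output as long as the inputs agree. *)
Lemma zs_output_causal H u1 u2 y1 y2 t : zs_output H u1 y1 -> zs_output H u2 y2 ->
  0 <= t -> (forall s, 0 <= s <= t -> u1 s = u2 s) -> y1 t = y2 t.
Proof.
move=> [k1 [A1 [B1 [C1 [D1 [z1 [HE1 [z1A y1E]]]]]]]].
move=> [k2 [A2 [B2 [C2 [D2 [z2 [HE2 [z2A y2E]]]]]]]] t0 u12.
have [D12 M0] := realization_unique (etrans (esym HE1) HE2).
have zA : ivp_sol 0 (fun s => block_mx A1 0 0 A2 *m col_mx (z1 s) (z2 s) +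
    col_mx (B1 *m u1 s) (B2 *m u2 s)) (fun s => col_mx (z1 s) (z2 s)).
  have := ivp_col_mx z1A z2A; rewrite col_mx0; apply: eq_ivp => // s s0.
  by rewrite mul_block_col !mul0mx addr0 add0r add_col_mx.
have /eqP : row_mx C1 (- C2) *m col_mx (z1 t) (z2 t) = 0.
  apply: (markov_output0 (t := t) zA) => [j s st|]; last by rewrite t0 lexx.
  by rewrite -u12// -mul_col_mx mulmxA M0 mul0mx.
rewrite mul_row_col mulNmx subr_eq0 => /eqP Cz.
by rewrite y1E// y2E// Cz D12 u12// t0 lexx.
Qed.

Lemma zs_output_exists H u u' y : zs_output H u y -> locint u' ->
  exists y', zs_output H u' y'.
Proof.
move=> [k [A [B [C [D [z [HE _]]]]]]] iu.
have [z' z'A] := linear_ivp_exists A (locint_mulmx B iu).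
exists (fun t => C *m z' t + D *m u' t).
by exists k, A, B, C, D, z'.
Qed.

Lemma zs_outputZ (c : R) H u y : zs_output H u y ->
  zs_output H (fun t => c *: u t) (fun t => c *: y t).
Proof.
move=> [k [A [B [C [D [z [HE [zA yE]]]]]]]].
exists k, A, B, C, D, (fun t => c *: z t); split=> //; split.
  have := ivp_mulmx c%:M zA; rewrite mulmx0; apply: eq_ivp => t t0.
    by rewrite mul_scalar_mx scalerDr !scalemxAr.
  by rewrite mul_scalar_mx.
by move=> t t0; rewrite yE// scalerDr !scalemxAr.
Qed.

(** Running [u2] through the realization of the first output does not change [y2], by
    [zs_output_causal]; the states can then be subtracted. *)
Lemma zs_outputB H u1 u2 y1 y2 : locint u2 -> zs_output H u1 y1 -> zs_output H u2 y2 ->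
  zs_output H (fun t => u1 t - u2 t) (fun t => y1 t - y2 t).
Proof.
move=> iu2 [k [A [B [C [D [z [HE [zA yE]]]]]]]] H2.
have [z' z'A] := linear_ivp_exists A (locint_mulmx B iu2).
have H2' : zs_output H u2 (fun t => C *m z' t + D *m u2 t).
  by exists k, A, B, C, D, z'.
exists k, A, B, C, D, (fun t => z t - z' t); split=> //; split.
  have := ivpB zA z'A; rewrite subr0; apply: eq_ivp => // t t0.
  by rewrite !mulmxBr opprD addrACA.
move=> t t0; rewrite yE// (zs_output_causal H2 H2' t0)//.
by rewrite !mulmxBr opprD addrACA.
Qed.

Lemma locint_trunc u (t : R) : locint u -> locint (fun s => if s <= t then u s else 0).
Proof.
move=> /locintP iu; apply/locintP => i T T0.
rewrite (_ : _ \o _ = (EFin \o (fun s => u s i 0)) \_ `]-oo, t]).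
  apply/integrable_restrict => //.
  by apply: integrableS (iu i T T0) => //; exact: measurableI.
apply/funext => s; rewrite /= patchE.
case: ifPn => st; first by rewrite mem_set//= in_itv.
by rewrite memNset ?mxE//= in_itv/=; exact/negP.
Qed.

(** Finiteness of the supremum in [L1norm]. An infinite supremum would be sent to [0] by [fine], and
    the norm would bound nothing. *)
Definition bibo_tf H := exists M : R, forall u y t, 0 <= t -> locint u ->
  (forall s, 0 <= s -> vnorm (u s) <= 1) -> zs_output H u y -> vnorm (y t) <= M.

Lemma L1norm_ge0 H : 0 <= L1norm H.
Proof.
rewrite /L1norm; set S := [set e | _].
have [->|/set0P[e Se]] := eqVneq S set0; first by rewrite ereal_sup0.
apply: fine_ge0; apply: (@le_trans _ _ e); last exact: ereal_sup_ubound.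
by have [u [y [t [_ _ _ _ ->]]]] := Se; rewrite lee_fin vnorm_ge0.
Qed.

Lemma L1norm_eq0 H : (forall u y t, 0 <= t -> locint u -> zs_output H u y -> y t = 0) ->
  L1norm H = 0.
Proof.
move=> y0; apply/eqP; rewrite eq_le L1norm_ge0 andbT; apply: fine_le0.
apply: ge_ereal_sup => e [u [y [t [t0 iu _ uy ->]]]].
by rewrite (y0 u y t)// vnorm0.
Qed.

Lemma L1norm_ub H u y t : bibo_tf H -> 0 <= t -> locint u ->
  (forall s, 0 <= s -> vnorm (u s) <= 1) -> zs_output H u y -> vnorm (y t) <= L1norm H.
Proof.
move=> [M HM] t0 iu u1 uy; rewrite /L1norm; set S := [set e | _].
have yS : S (vnorm (y t))%:E by exists u, y, t.
have Sge : ((vnorm (y t))%:E <= ereal_sup S)%E by exact: ereal_sup_ubound.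
have Sle : (ereal_sup S <= M%:E)%E.
  apply: ge_ereal_sup => e [u' [y' [t' [t'0 iu' u'1 uy' ->]]]].
  by rewrite lee_fin; exact: HM uy'.
rewrite -lee_fin fineK// fin_numElt (lt_le_trans _ Sge) ?ltNyr//.
by rewrite (le_lt_trans Sle) ?ltry.
Qed.

(** By causality the input may be cut off after [t], so a bound on [[0, t]] suffices. Rescaling by
    some [d > c] rather than by [c] covers [c = 0]; then [d] tends to [c]. *)
Lemma L1norm_bound H u y t c : bibo_tf H -> zs_output H u y -> locint u -> 0 <= t ->
  (forall s, 0 <= s <= t -> vnorm (u s) <= c) -> vnorm (y t) <= L1norm H * c.
Proof.
move=> bH uy iu t0 uc.
have c0 : 0 <= c by rewrite (le_trans (vnorm_ge0 (u 0)))// uc// lexx.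
have L0 := L1norm_ge0 H.
have main d : c < d -> vnorm (y t) <= L1norm H * d.
  move=> cd; have d0 : 0 < d by exact: le_lt_trans cd.
  pose u' s := d^-1 *: (if s <= t then u s else 0).
  have iu' : locint u'.
    apply: eq_locint (locint_mulmx d^-1%:M (locint_trunc t iu)) => s s0.
    by rewrite mul_scalar_mx.
  have [y' uy'] := zs_output_exists uy iu'.
  have E : y' t = d^-1 *: y t.
    apply: (zs_output_causal uy' (zs_outputZ d^-1 uy) t0) => s /andP[s0 st].
    by rewrite /u' st.
  have : vnorm (y' t) <= L1norm H.
    apply: (L1norm_ub bH t0 iu' _ uy') => s s0; rewrite /u'.
    case: ifPn => st; last by rewrite scaler0 vnorm0.
    rewrite (le_trans (vnormZ _ _))// gtr0_norm ?invr_gt0// mulrC ler_pdivrMr// mul1r.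
    by rewrite (le_trans _ (ltW cd))// uc// s0.
  rewrite E => yL.
  have -> : y t = d *: (d^-1 *: y t) by rewrite scalerA divff ?gt_eqF// scale1r.
  by rewrite (le_trans (vnormZ _ _))// gtr0_norm// mulrC ler_wpM2r// ltW.
apply/ler_addgt0Pr => e e0.
have L1 : 0 < L1norm H + 1 by rewrite ltr_pwDr.
apply: le_trans (main (c + e / (L1norm H + 1)) _) _; first by rewrite ltrDl divr_gt0.
by rewrite mulrDr lerD2l mulrA ler_pdivrMr// mulrC ler_wpM2l ?(ltW e0)// lerDl.
Qed.

Lemma realization_bibo k (A : 'M[R]_k) (B : 'M[R]_(k, q)) (C : 'M[R]_(p, k))
    (D : 'M[R]_(p, q)) H :
  bibo_mx A -> H = mxF C *m resolvent A *m mxF B + mxF D -> bibo_tf H.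
Proof.
move=> [M M0 HM] HE.
exists (mnorm C * (M * mnorm B) + mnorm D) => u y t t0 iu u1 uy.
have [z zA] := linear_ivp_exists A (locint_mulmx B iu).
have H' : zs_output H u (fun t => C *m z t + D *m u t) by exists k, A, B, C, D, z.
rewrite (zs_output_causal uy H' t0)// (le_trans (vnormD _ _))// lerD//.
  rewrite (le_trans (vnorm_mulmx _ _))// ler_wpM2l ?mnorm_ge0//.
  apply: HM zA t t0 => [|s s0]; first exact: mnorm_ge0.
  by rewrite (le_trans (vnorm_mulmx _ _))// ler_piMr ?mnorm_ge0 ?u1.
by rewrite (le_trans (vnorm_mulmx _ _))// ler_piMr ?mnorm_ge0 ?u1.
Qed.

End TransferOutput.

(** * Realizations of the transfer matrices of the loop *)

Section Realizations.
Variable R : realType.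
Variables (m n : nat) (kf : 'I_m -> R) (Am Ae : 'M[R]_n) (B : 'M[R]_(n, m))
  (N : 'M[R]_(m, n)).
Hypotheses (kf0 : forall j, 0 < kf j) (hAm : hurwitz Am).

Local Notation sI := ((sF R)%:M).
Local Notation C := (Cfilt kf).

(** The filter is [(sI + K)^-1 K], with state equation [w' = - K w + K u]. *)
Definition filter_gain : 'M[R]_m := diag_mx (\row_j kf j).
Local Notation K := filter_gain.

Lemma sF_addC_neq0 (c : R) : sF R + Defs.cst c != 0.
Proof.
rewrite /sF /Defs.cst -tofracD tofrac_eq0; apply: monic_neq0.
by rewrite -[c]opprK polyCN monicXsubC.
Qed.

Lemma filter_equation : (sI - mxF (- K)) *m C = mxF K.
Proof.
have -> : sI - mxF (- K) = diag_mx (\row_j (sF R + Defs.cst (kf j))).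
  apply/matrixP => i j; rewrite mxFN opprK !mxE; case: eqP => [->|_] /=.
    by rewrite !mulr1n.
  by rewrite !mulr0n /Defs.cst polyC0 tofrac0 addr0.
rewrite /Cfilt mulmx_diag; apply/matrixP => i j; rewrite !mxE.
case: eqP => [->|_] /=; last by rewrite !mulr0n /Defs.cst polyC0 tofrac0.
by rewrite !mulr1n mulrC divfK// sF_addC_neq0.
Qed.

Lemma filter_realization : C = mxF 1%:M *m resolvent (- K) *m mxF K + mxF 0.
Proof. by rewrite mxF1 mul1mx mxF0 addr0; exact: resolvent_unique filter_equation. Qed.

Lemma resolvent_realization q (D : 'M[R]_(n, q)) :
  resolvent Am *m mxF D = mxF 1%:M *m resolvent Am *m mxF D + mxF 0.
Proof. by rewrite mxF1 mul1mx mxF0 addr0. Qed.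

(** [s (sI - Am)^-1 = (sI - Am)^-1 Am + 1]: multiplication by [s] only adds a direct term. *)
Lemma sresolvent_realization :
  sF R *: resolvent Am = mxF 1%:M *m resolvent Am *m mxF Am + mxF 1%:M.
Proof.
rewrite mxF1 mul1mx; apply/eqP; rewrite addrC -subr_eq; apply/eqP.
rewrite -mul_mx_scalar -mulmxBr.
by rewrite /resolvent mulVmx ?char_mxF_unit.
Qed.

Let HC := resolvent Am *m mxF B.

Lemma Hxm_equation q (X : 'M[tf R]_(m, q)) :
  (sI - mxF Am) *m (HC *m X) = mxF B *m X.
Proof. by rewrite /HC !mulmxA mulmxV ?char_mxF_unit// mul1mx. Qed.

Lemma cascade_equation q (B' : 'M[R]_(n, m)) (X : 'M[tf R]_(n, q)) (Y : 'M[tf R]_(m, q)) :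
  (sI - mxF (block_mx Am B' 0 (- K))) *m col_mx X Y =
  col_mx ((sI - mxF Am) *m X - mxF B' *m Y) ((sI - mxF (- K)) *m Y).
Proof.
rewrite mxF_block mxF0 scalar_mx_block opp_block_mx add_block_mx mul_block_col.
by rewrite oppr0 addr0 add0r mul0mx add0r mulNmx.
Qed.

(* The transfer matrices of (C1)-(C3) and [gamma2]: [Gtf] is G_xm and, for
   [N = mppinv B], [Etf] and [Ptf] map the prediction error to its contributions to
   the state and to the control. *)
Definition Gtf := HC *m (1%:M - C).

(** The system [x' = Am x + B (u - w)], with [w] the filtered [u], accounts for the factor
    [1 - C]. *)
Lemma Gtf_realization : Gtf =
  mxF (row_mx 1%:M 0) *m resolvent (block_mx Am (- B) 0 (- K)) *m mxF (col_mx B K)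
  + mxF 0.
Proof.
rewrite mxF0 addr0 -mulmxA.
rewrite -(@resolvent_unique _ _ _ _ (col_mx Gtf C) (mxF (col_mx B K))).
  by rewrite mxF_row mxF1 mxF0 mul_row_col mul1mx mul0mx addr0.
rewrite cascade_equation filter_equation Hxm_equation mxF_col mxFN mulNmx opprK.
by rewrite mulmxBr mulmx1 subrK.
Qed.

Definition Ptf := C *m mxF N *m (sI - mxF Ae).
(** [C N (sI - Ae)] is proper because the filter has relative degree one. Splitting off the direct
    term [K N] leaves [(sI + K)^-1 Pgain]. *)
Definition Pgain := - (K *m (K *m N + N *m Ae)).

Lemma Ptf_equation : (sI - mxF (- K)) *m (Ptf - mxF (K *m N)) = mxF Pgain.
Proof.
rewrite mulmxBr /Ptf !mulmxA filter_equation /Pgain !mxFN opprK !mxFM mxFD !mxFM.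
rewrite mulmxBr mulmxDl mul_mx_scalar mul_scalar_mx mulmxDr !mulmxA.
by rewrite opprD addrACA subrr add0r opprD addrC.
Qed.

Lemma Ptf_realization :
  Ptf = mxF 1%:M *m resolvent (- K) *m mxF Pgain + mxF (K *m N).
Proof.
rewrite mxF1 mul1mx -(resolvent_unique Ptf_equation).
by rewrite subrK.
Qed.

Definition Etf := HC *m C *m mxF N *m (sI - mxF Ae).

Lemma Etf_realization : Etf =
  mxF (row_mx 1%:M 0) *m resolvent (block_mx Am B 0 (- K))
    *m mxF (col_mx (B *m K *m N) Pgain) + mxF 0.
Proof.
rewrite mxF0 addr0 -mulmxA.
rewrite -(@resolvent_unique _ _ _ _ (col_mx Etf (Ptf - mxF (K *m N)))
  (mxF (col_mx (B *m K *m N) Pgain))).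
  by rewrite mxF_row mxF1 mxF0 mul_row_col mul1mx mul0mx addr0.
rewrite cascade_equation Ptf_equation mxF_col; congr col_mx.
have -> : Etf = HC *m Ptf by rewrite /Etf /Ptf !mulmxA.
by rewrite Hxm_equation mulmxBr opprB addrC subrK !mxFM !mulmxA.
Qed.

Lemma filter_bibo_mx : bibo_mx (- K).
Proof. by apply: bibo_diag => i; rewrite mxE. Qed.

Let bAm := hurwitz_bibo hAm.

Lemma filter_bibo : bibo_tf C.
Proof. exact: realization_bibo filter_bibo_mx filter_realization. Qed.

Lemma resolvent_bibo q (D : 'M[R]_(n, q)) : bibo_tf (resolvent Am *m mxF D).
Proof. exact: realization_bibo bAm (resolvent_realization D). Qed.

Lemma sresolvent_bibo : bibo_tf (sF R *: resolvent Am).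
Proof. exact: realization_bibo bAm sresolvent_realization. Qed.

Lemma Gtf_bibo : bibo_tf Gtf.
Proof. exact: realization_bibo (bibo_cascade _ bAm filter_bibo_mx) Gtf_realization. Qed.

Lemma Ptf_bibo : bibo_tf Ptf.
Proof. exact: realization_bibo filter_bibo_mx Ptf_realization. Qed.

Lemma Etf_bibo : bibo_tf Etf.
Proof. exact: realization_bibo (bibo_cascade _ bAm filter_bibo_mx) Etf_realization. Qed.

Implicit Types (u w : R -> 'cV[R]_m) (x y z : R -> 'cV[R]_n).

Lemma filter_output u w : ivp_sol 0 (fun t => - K *m w t + K *m u t) w ->
  zs_output C u w.
Proof.
move=> wA; exists m, (- K), K, 1%:M, 0, w; split; first exact: filter_realization.
by split=> // t t0; rewrite mul1mx mul0mx addr0.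
Qed.

Lemma filterN_output u w : ivp_sol 0 (fun t => - K *m w t + K *m u t) w ->
  zs_output (- C) u (fun t => - w t).
Proof.
move=> wA; exists m, (- K), K, (- 1%:M), 0, w; split.
  by rewrite {1}filter_realization !mxF0 !addr0 mxFN !mulNmx.
by split=> // t t0; rewrite mulNmx mul1mx mul0mx addr0.
Qed.

(** Comparison with the standard realization forces the direct term to vanish, so the output is a
    linear image of a continuous state whatever [u] is. *)
Lemma filterN_locint u w : zs_output (- C) u w -> locint w.
Proof.
move=> [k [A [B' [C' [D [z [HE [zA wE]]]]]]]].
have HN : - C = mxF (- 1%:M) *m resolvent (- K) *m mxF K + mxF 0.
  by rewrite {1}filter_realization !mxF0 !addr0 mxFN !mulNmx.
have [D0 _] := realization_unique (etrans (esym HE) HN).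
apply: eq_locint (locint_mulmx C' (ivp_locint zA)) => t t0.
by rewrite wE// D0 mul0mx addr0.
Qed.

Lemma resolvent_output q (D : 'M[R]_(n, q)) v x :
  ivp_sol 0 (fun t => Am *m x t + D *m v t) x -> zs_output (resolvent Am *m mxF D) v x.
Proof.
move=> xA; exists n, Am, D, 1%:M, 0, x; split; first exact: resolvent_realization.
by split=> // t t0; rewrite mul1mx mul0mx addr0.
Qed.

(** [x - x0] starts at zero and is driven by the constant input [x0]; this is why [rho_in] measures
    the effect of the initial state. *)
Lemma sresolvent_output (x0 : 'cV[R]_n) x : ivp_sol x0 (fun t => Am *m x t) x ->
  zs_output (sF R *: resolvent Am) (fun=> x0) x.
Proof.
move=> xA; exists n, Am, Am, 1%:M, 1%:M, (fun t => x t - x0).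
split; first exact: sresolvent_realization.
split; last by move=> t t0; rewrite !mul1mx subrK.
have := ivpB xA (ivp_cst x0); rewrite subrr; apply: eq_ivp => // t t0.
by rewrite subr0 -mulmxDr subrK.
Qed.

Lemma Gtf_output u w x : ivp_sol 0 (fun t => - K *m w t + K *m u t) w ->
  ivp_sol 0 (fun t => Am *m x t + B *m (u t - w t)) x -> zs_output Gtf u x.
Proof.
move=> wA xA; exists (n + m)%N, (block_mx Am (- B) 0 (- K)), (col_mx B K), (row_mx 1%:M 0), 0,
  (fun t => col_mx (x t) (w t)).
split; first exact: Gtf_realization.
split; last by move=> t t0; rewrite mul_row_col mul1mx !mul0mx !addr0.
have := ivp_col_mx xA wA; rewrite col_mx0; apply: eq_ivp => // t t0.
rewrite mul_block_col mul_col_mx add_col_mx mul0mx add0r mulNmx mulmxBr.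
by congr col_mx; rewrite mulNmx addrA addrAC.
Qed.

Lemma Ptf_output y w : ivp_sol 0 (fun t => - K *m w t + Pgain *m y t) w ->
  zs_output Ptf y (fun t => w t + K *m N *m y t).
Proof.
move=> wA; exists m, (- K), Pgain, 1%:M, (K *m N), w; split; first exact: Ptf_realization.
by split=> // t t0; rewrite mul1mx.
Qed.

Lemma Etf_output y w x : ivp_sol 0 (fun t => - K *m w t + Pgain *m y t) w ->
  ivp_sol 0 (fun t => Am *m x t + B *m (w t + K *m N *m y t)) x -> zs_output Etf y x.
Proof.
move=> wA xA; exists (n + m)%N, (block_mx Am B 0 (- K)), (col_mx (B *m K *m N) Pgain),
  (row_mx 1%:M 0), 0, (fun t => col_mx (x t) (w t)).
split; first exact: Etf_realization.
split; last by move=> t t0; rewrite mul_row_col mul1mx !mul0mx !addr0.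
have := ivp_col_mx xA wA; rewrite col_mx0; apply: eq_ivp => // t t0.
by rewrite mul_block_col mul_col_mx add_col_mx mul0mx add0r mulmxDr !mulmxA addrA.
Qed.

End Realizations.

(** * The sampled prediction error *)

Section SampledError.
Variable R : realType.
Local Notation mu := (@lebesgue_measure R).

Lemma archimedean_le0 (a c : R) : (forall i : nat, i%:R * a <= c) -> a <= 0.
Proof.
move=> H; rewrite leNgt; apply/negP => a0.
have c0 : 0 <= c by have := H 0%N; rewrite mul0r.
have /archi_boundP : 0 <= c / a by rewrite divr_ge0// ltW.
by rewrite ltr_pdivrMr// => /lt_le_trans/(_ (H _)); rewrite ltxx.
Qed.

Lemma mulmx_inj_unit k (A : 'M[R]_k) :
  (forall v : 'cV[R]_k, A *m v = 0 -> v = 0) -> A \in unitmx.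
Proof.
move=> A0; rewrite unitmxE unitfE -det_tr; apply/negP => /det0P[v v0 vA].
move/eqP: v0; apply; apply: trmx_inj; rewrite trmx0; apply: A0.
by apply: trmx_inj; rewrite trmx_mul trmxK vA trmx0.
Qed.

Lemma ivp_line k (v : 'cV[R]_k) : ivp_sol 0 (fun=> v) (fun t => t *: v).
Proof.
apply/ivpP; split=> [|i]; first by rewrite scale0r.
by apply: eq_primitive (primitive_id (v i 0)) => // t t0; rewrite mxE mulrC.
Qed.

Lemma vnormZ_eq k (c : R) (v : 'cV[R]_k) : vnorm (c *: v) = `|c| * vnorm v.
Proof.
apply/eqP; rewrite eq_le vnormZ/=; have [->|c0] := eqVneq c 0.
  by rewrite normr0 mul0r vnorm_ge0.
rewrite -ler_pdivlMl ?normr_gt0// -normfV; apply: le_trans (vnormZ _ _).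
by rewrite scalerA mulVf// scale1r.
Qed.

(** A kernel vector [v] would give the unbounded response [t v] to the constant input [v]. *)
Lemma bibo_unit k (A : 'M[R]_k) : bibo_mx A -> A \in unitmx.
Proof.
move=> [M M0 HM]; apply: mulmx_inj_unit => v Av; apply: vnorm_eq0.
apply: (@archimedean_le0 _ (M * vnorm v)) => i.
have zA : ivp_sol 0 (fun t => A *m (t *: v) + v) (fun t => t *: v).
  by apply: eq_ivp (ivp_line v) => // t t0; rewrite -scalemxAr Av scaler0 add0r.
have := HM _ _ _ (vnorm_ge0 v) (fun t _ => lexx (vnorm v)) zA i%:R.
by rewrite vnormZ_eq normr_nat; apply.
Qed.

Lemma ivp_expmx k (A : 'M[R]_k) z0 (F z : R -> 'cV[R]_k) : ivp_sol z0 F z ->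
  ivp_sol z0 (fun t => A *m (expmx (t *: A) *m z t) + expmx (t *: A) *m F t)
    (fun t => expmx (t *: A) *m z t).
Proof.
move=> zF.
have := @ivp_mulmx_fun _ _ _ (fun t => expmx (t *: A)) (fun t => A *m expmx (t *: A))
  _ _ _ _ _ zF.
rewrite expmx0 mul1mx => H; apply: eq_ivp (H _ _) => // [t t0|i j t|i j].
- by rewrite addrC mulmxA.
- exact: is_derive_expmx.
- apply: (@continuous_mulmx _ _ _ _ (fun=> A) (fun t => expmx (t *: A))).
    exact: continuous_cstmx.
  exact: expmx_continuous.
Qed.

(* Resonance: if [e^(TA) v = v] then [t e^(tA) v] is an unbounded response to the
   bounded input [e^(tA) v]. *)
Lemma bibo_expmx_sub1_unit k (A : 'M[R]_k) (T : R) : 0 < T -> bibo_mx A ->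
  expmx (T *: A) - 1%:M \in unitmx.
Proof.
move=> T0 [M M0 HM]; apply: mulmx_inj_unit => v.
rewrite mulmxBl mul1mx => /eqP; rewrite subr_eq0 => /eqP Ev.
have EvN i : expmx ((i%:R * T) *: A) *m v = v.
  elim: i => [|i IH]; first by rewrite mul0r expmx0 mul1mx.
  by rewrite -natr1 mulrDl mul1r expmxD -mulmxA Ev.
(* [e^(tA) v - v] is the response to the constant input [A v], so [c] bounds [e^(tA) v] for all
   [t >= 0]. *)
pose c := M * vnorm (A *m v) + vnorm v.
have Eb t : 0 <= t -> vnorm (expmx (t *: A) *m v) <= c.
  move=> t0; rewrite -[_ *m v](subrK v) (le_trans (vnormD _ _))// lerD//.
  have zA : ivp_sol 0 (fun t => A *m (expmx (t *: A) *m v - v) + A *m v)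
      (fun t => expmx (t *: A) *m v - v).
    have := ivpB (ivp_expmx A (ivp_cst v)) (ivp_cst v); rewrite subrr.
    by apply: eq_ivp => // s s0; rewrite mulmx0 addr0 subr0 mulmxBr subrK.
  exact: (HM _ _ _ (vnorm_ge0 (A *m v)) (fun t _ => lexx _) zA t t0).
have c0 : 0 <= c by rewrite addr_ge0 ?mulr_ge0 ?vnorm_ge0.
have zb := HM c _ _ c0 Eb (ivp_expmx A (ivp_line v)).
apply: vnorm_eq0; rewrite -(ler_pM2l T0) mulr0.
apply: (@archimedean_le0 _ (M * c)) => i.
have iT : 0 <= i%:R * T by rewrite mulr_ge0// ltW.
have := zb _ iT; rewrite -scalemxAr EvN vnormZ_eq ger0_norm//.
by rewrite mulrA.
Qed.

Lemma continuous_bigmax (I : Type) (r : seq I) (F : I -> R -> R) :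
  (forall i, continuous (F i)) -> continuous (fun t => \big[Num.max/0]_(i <- r) F i t).
Proof.
move=> cF; elim: r => [|i r IH].
  by under eq_fun do rewrite big_nil; exact: cst_continuous.
under eq_fun do rewrite big_cons.
by move=> t; exact: (continuous_max (cF i t) (IH t)).
Qed.

Lemma mnorm_continuous p q (P : R -> 'M[R]_(p, q)) :
  (forall i j, continuous (fun t => P t i j)) -> continuous (fun t => mnorm (P t)).
Proof.
move=> cP; apply: continuous_bigmax => i t.
apply: (@cvg_sumr R _ _ (nbhs t) _ _ (fun j t => `|P t i j|) (fun j => `|P t i j|)) => j.
by apply: cvg_norm; exact: cP.
Qed.

Lemma expmx_mulmx_continuous k q (A : 'M[R]_k) (B : 'M[R]_(k, q)) :
  continuous (fun t : R => mnorm (expmx (t *: A) *m B)).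
Proof.
apply: mnorm_continuous.
apply: (@continuous_mulmx _ _ _ _ (fun t => expmx (t *: A)) (fun=> B)).
  exact: expmx_continuous.
exact: continuous_cstmx.
Qed.

(** Rewrites the convolution integrals in [alpha0] and [alpha2] with an integrand independent of the
    upper limit, which makes them monotone in it. *)
Lemma Rintegral_reflect (psi : R -> R) (a t : R) : continuous psi -> a <= t ->
  \int[mu]_(s in `[a, t]) psi (t - s) = \int[mu]_(s in `[0, t - a]) psi s.
Proof.
move=> cpsi at_.
pose F (s : R) := t - s.
have dF s : is_derive s (1 : R) F (- 1).
  have D := is_deriveB (is_derive_cst t s (1 : R)) (is_derive_id s (1 : R)).
  by apply: (@is_derive_eq _ _ _ _ _ _ _ _ D); rewrite sub0r.
have F'E : derive1 F = fun=> - 1.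
  by apply/funext => s; rewrite derive1E; apply: (@derive_val _ _ _ _ _ _ _ (dF s)).
have cF : continuous F.
  by move=> s; apply: cvgB; [exact: cvg_cst|exact: cvg_id].
have := @integration_by_substitution_decreasing R F psi a t at_.
rewrite F'E => H.
have -> : \int[mu]_(s in `[0, t - a]) psi s = \int[mu]_(s in `[F t, F a]) psi s.
  by rewrite /F subrr.
rewrite /Rintegral H.
- by congr fine; apply: eq_integral => s _; rewrite /= opprK mulr1.
- by move=> x y _ _ xy; rewrite /F ltrD2l ltrN2.
- by move=> x _; exact: cst_continuous.
- exact: is_cvg_cst.
- exact: is_cvg_cst.
- split.
  + by move=> s _; apply: (@ex_derive _ _ _ _ _ _ _ (dF s)).
  + exact/cvg_at_right_filter/cF.
  + exact/cvg_at_left_filter/cF.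
- exact: continuous_subspaceT.
Qed.

End SampledError.

(** * Evolution of the error within one sampling interval *)

Section SampledStep.
Variable R : realType.
Local Notation mu := (@lebesgue_measure R).

Lemma Rintegral_itv0_le (psi : R -> R) (a b : R) : continuous psi ->
  (forall s, 0 <= psi s) -> 0 <= a -> a <= b ->
  \int[mu]_(s in `[0, a]) psi s <= \int[mu]_(s in `[0, b]) psi s.
Proof.
move=> cpsi psi0 a0 ab; rewrite -subr_ge0.
rewrite (primitive_int (primitive_integral (continuous_locint1 cpsi)))//.
by apply: Rintegral_ge0 => s _.
Qed.

Lemma expmx_inv_comm k (A : 'M[R]_k) (t : R) : A \in unitmx ->
  expmx (t *: A) *m invmx A = invmx A *m expmx (t *: A).
Proof.
move=> uA; transitivity (invmx A *m (A *m (expmx (t *: A) *m invmx A))).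
  by rewrite mulKmx.
by rewrite (mulmxA A) -expmx_comm -(mulmxA _ A) mulmxV// mulmx1.
Qed.

(** Shifting by the equilibrium [invmx A *m eta] of the held input leaves [- B f] as the only input
    on [[a, t)], and variation of constants from [a] bounds its contribution. *)
Lemma sampled_step k q (A : 'M[R]_k) (B : 'M[R]_(k, q)) (xt h : R -> 'cV[R]_k)
    (f : R -> 'cV[R]_q) (eta : 'cV[R]_k) (a t b : R) :
  A \in unitmx -> 0 <= b -> 0 <= a -> a <= t ->
  ivp_sol 0 (fun s => A *m xt s + h s - B *m f s) xt ->
  (forall s, a <= s < t -> h s = - eta) ->
  (forall s, 0 <= s <= t -> vnorm (f s) <= b) ->
  vnorm (xt t - (expmx ((t - a) *: A) *m xt a
                 - (expmx ((t - a) *: A) *m (invmx A *m eta) - invmx A *m eta))) <=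
  b * \int[mu]_(s in `[0, t - a]) mnorm (expmx (s *: A) *m B).
Proof.
move=> uA b0 a0 at_ xA hE fb; set zeta := invmx A *m eta.
have Azeta : A *m zeta = eta by rewrite /zeta mulKVmx.
pose g s := eta + h s - B *m f s.
have yA : ivp_sol (0 - zeta) (fun s => A *m (xt s - zeta) + g s) (fun s => xt s - zeta).
  apply: eq_ivp (ivpB xA (ivp_cst zeta)) => // s s0.
  by rewrite subr0 mulmxBr Azeta /g !addrA subrK.
have V := ivp_mulmx (expmx (t *: A)) (variation_of_constants yA).
pose psi s := mnorm (expmx (s *: A) *m B).
have cpsi : continuous psi by exact: expmx_mulmx_continuous.
have cpsit : continuous (fun s => psi (t - s)).
  move=> s; apply: (@continuous_comp _ _ _ (fun s : R => t - s) psi); last exact: cpsi.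
  by apply: cvgB; [exact: cvg_cst|exact: cvg_id].
have ipsi : mu.-integrable `[a, t] (EFin \o (fun s => b * psi (t - s))).
  apply: locint1S => //; apply: locint1Z; apply: continuous_locint1; exact: cpsit.
have ipsi1 : mu.-integrable `[a, t] (EFin \o (fun s => psi (t - s))).
  by apply: locint1S => //; exact: continuous_locint1.
have psi0 s : 0 <= psi s by exact: mnorm_ge0.
have subs : `[a, t[ `<=` `[a, t]%classic by apply: subset_itvl; rewrite bnd_simp.
apply/vnorm_leP; split=> [|i].
  by apply: mulr_ge0 => //; apply: Rintegral_ge0 => s _; exact: psi0.
have P := ivp_coord i V; have iP := locint1S t a0 (proj1 P).
pose W s := expmx (t *: A) *m (expmx ((- s) *: A) *m (xt s - zeta)).
have WE s : W s = expmx ((t - s) *: A) *m (xt s - zeta) by rewrite /W mulmxA -expmxD.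
rewrite (_ : xt t - _ = W t - W a); last first.
  rewrite !WE subrr expmx0 mul1mx mulmxBr; move: (_ *m zeta) (_ *m xt a) => u v.
  by apply/colP => j; rewrite !mxE; ring.
have subE (X Y : 'cV[R]_k) : (X - Y) i 0 = X i 0 - Y i 0 by rewrite !mxE.
rewrite subE (primitive_int P a0 at_) -(Rintegral_reflect cpsi at_) -RintegralZl//.
(* At [s = t] the next sample may already be in force, so that endpoint is dropped from both
   integrals. *)
rewrite -[X in `|X|]Rintegral_itv_bndo_bndc; last exact: integrableS iP.
rewrite -[X in _ <= X]Rintegral_itv_bndo_bndc; last exact: integrableS ipsi.
apply: le_trans (le_normr_Rintegral _ _) _ => //; first exact: integrableS iP.
apply: le_Rintegral => //.
- by apply: integrable_norm; exact: integrableS iP.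
- exact: integrableS ipsi.
move=> s; rewrite /= in_itv/= => /andP[as_ st].
have -> : g s = - (B *m f s) by rewrite /g hE ?as_// subrr add0r.
apply: le_trans (vnorm_coord _ _) _.
rewrite mulmxA -expmxD mulmxN vnormN mulmxA.
apply: le_trans (vnorm_mulmx _ _) _; rewrite mulrC ler_wpM2r ?mnorm_ge0//.
by apply: fb; rewrite (le_trans a0 as_) ltW.
Qed.

End SampledStep.

(** * Dead-beat samples and the bound on the prediction error *)

Section SampledErrorBound.
Variable R : realType.
Local Notation mu := (@lebesgue_measure R).
Variables (k q : nat) (A : 'M[R]_k) (B : 'M[R]_(k, q)) (T : R).
Hypotheses (hA : hurwitz A) (T0 : 0 < T).

Lemma alpha0E : alpha0 A B T = \int[mu]_(s in `[0, T]) mnorm (expmx (s *: A) *m B).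
Proof.
rewrite -[X in `[0, X]](subr0 T) -(Rintegral_reflect (@expmx_mulmx_continuous R k q A B))//.
exact: ltW.
Qed.

Lemma alpha0_ge (t : R) : 0 <= t -> t <= T ->
  \int[mu]_(s in `[0, t]) mnorm (expmx (s *: A) *m B) <= alpha0 A B T.
Proof.
move=> t0 tT; rewrite alpha0E; apply: Rintegral_itv0_le => //.
  exact: expmx_mulmx_continuous.
by move=> s; exact: mnorm_ge0.
Qed.

Lemma alpha0_ge0 : 0 <= alpha0 A B T.
Proof. by apply: Rintegral_ge0 => s _; exact: mnorm_ge0. Qed.

Lemma alpha1_ge (t : R) : 0 <= t -> t <= T -> mnorm (expmx (t *: A)) <= alpha1 A T.
Proof.
move=> t0 tT; apply: ub_le_sup; last by exists t => //=; rewrite t0.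
have [M MP] := continuous_bounded_itv 0 T (mnorm_continuous (@expmx_continuous R k A)).
by exists M => _ [s /= sT <-]; apply: le_trans (ler_norm _) (MP s sT).
Qed.

(** Gain of the adaptive law once [row_mx B Bperp] has been multiplied back: the held input is
    [- N xt(iT)]. *)
Let N := invmx (PhiT A T) *m expmx (T *: A).

Lemma alpha2_ge (t : R) : 0 <= t -> t <= T ->
  \int[mu]_(s in `[0, t]) mnorm (expmx (s *: A) *m N) <= alpha2 A T.
Proof.
have cN := @expmx_mulmx_continuous R k k A N.
have E (r : R) : 0 <= r -> \int[mu]_(tau in `[0, r])
    mnorm (expmx ((r - tau) *: A) *m invmx (PhiT A T) *m expmx (T *: A)) =
    \int[mu]_(s in `[0, r]) mnorm (expmx (s *: A) *m N).
  move=> r0; rewrite -[X in _ = \int[mu]_(s in `[0, X]) _](subr0 r).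
  rewrite -(Rintegral_reflect cN)//.
  by apply: eq_Rintegral => s _; rewrite /N mulmxA.
move=> t0 tT; apply: ub_le_sup; last by exists t => //=; [rewrite t0|rewrite E].
exists (\int[mu]_(s in `[0, T]) mnorm (expmx (s *: A) *m N)) => _ [s /= /andP[s0 sT] <-].
rewrite E//; apply: Rintegral_itv0_le => // r; exact: mnorm_ge0.
Qed.

Let bA := hurwitz_bibo hA.
Let uA := bibo_unit bA.

Lemma PhiT_unit : PhiT A T \in unitmx.
Proof. by rewrite unitmx_mul unitmx_inv uA bibo_expmx_sub1_unit. Qed.

(** [(e^(tA) - 1) A^-1] is the integral of [e^(sA)] over [[0, t]], which brings in the integral
    defining [alpha2]. *)
Lemma expmx_increment_bound (t : R) (xi : 'cV[R]_k) : 0 <= t -> t <= T ->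
  vnorm (expmx (t *: A) *m (invmx A *m (N *m xi)) - invmx A *m (N *m xi)) <=
  alpha2 A T * vnorm xi.
Proof.
move=> t0 tT; set zeta := invmx A *m _.
have Z := ivp_expmx A (ivp_cst zeta).
have cN := @expmx_mulmx_continuous R k k A N.
have P := primitiveZ (vnorm xi) (primitive_integral (continuous_locint1 cN)).
apply: (@le_trans _ _ (vnorm xi * \int[mu]_(s in `[0, t]) mnorm (expmx (s *: A) *m N))).
  apply/vnorm_leP; split=> [|i].
    by rewrite mulr_ge0 ?vnorm_ge0//; apply: Rintegral_ge0 => s _; exact: mnorm_ge0.
  have := primitive_norm_le (ivp_coord i Z) P (lexx 0) t0.
  rewrite set_itv1 Rintegral_set1 mulr0 subr0 expmx0 mul1mx.
  have -> : (expmx (t *: A) *m zeta - zeta) i 0 = (expmx (t *: A) *m zeta) i 0 - zeta i 0.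
    by move: (_ *m zeta) => w; rewrite !mxE.
  apply=> s /andP[s0 st]; rewrite mulmx0 addr0 mulmxA -expmx_comm -mulmxA.
  rewrite /zeta mulKVmx// mulmxA.
  by rewrite (le_trans (vnorm_coord _ _))// mulrC vnorm_mulmx.
by rewrite mulrC ler_wpM2r ?vnorm_ge0// alpha2_ge.
Qed.

(** [(e^(TA) - 1) A^-1] equals [PhiT A T], the matrix inverted in the gain [N]: after a full period
    the held input cancels [e^(TA) xi] exactly. *)
Lemma expmx_deadbeat (xi : 'cV[R]_k) :
  expmx (T *: A) *m xi -
    (expmx (T *: A) *m (invmx A *m (N *m xi)) - invmx A *m (N *m xi)) = 0.
Proof.
set zeta := invmx A *m _; apply/eqP; rewrite subr_eq0; apply/eqP.
have -> : expmx (T *: A) *m zeta - zeta = PhiT A T *m (N *m xi).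
  rewrite /zeta (mulmxA _ (invmx A)) expmx_inv_comm// /PhiT mulmxBr mulmx1 mulmxBl.
  by [].
by rewrite /N -(mulmxA (invmx _)) mulKVmx// PhiT_unit.
Qed.

Variables (xt h : R -> 'cV[R]_k) (f : R -> 'cV[R]_q) (b t0 : R).
Hypotheses (b0 : 0 <= b)
  (xtA : ivp_sol 0 (fun t => A *m xt t + h t - B *m f t) xt)
  (hE : forall (i : nat) (t : R), i%:R * T <= t < i.+1%:R * T ->
     h t = - (N *m xt (i%:R * T)))
  (fb : forall s, 0 <= s <= t0 -> vnorm (f s) <= b).

(** Since the previous sample is cancelled exactly, a sample retains only the disturbance of the
    last period and errors do not accumulate. *)
Lemma sampled_point_bound (i : nat) : i%:R * T <= t0 ->
  vnorm (xt (i%:R * T)) <= b * alpha0 A B T.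
Proof.
case: i => [_|i iT].
  by rewrite mul0r (ivp_at0 xtA) vnorm0 mulr_ge0// alpha0_ge0.
have a0 : 0 <= i%:R * T by rewrite mulr_ge0// ltW.
have d : i.+1%:R * T - i%:R * T = T by rewrite -mulrBl -natrB// subSnn mul1r.
have ai : i%:R * T <= i.+1%:R * T by rewrite -subr_ge0 d ltW.
have := @sampled_step _ _ _ _ B xt h f (N *m xt (i%:R * T)) _ _ b uA b0 a0 ai xtA (@hE i).
rewrite d expmx_deadbeat subr0 -alpha0E; apply => s /andP[s0 st].
by apply: fb; rewrite s0 (le_trans st).
Qed.

(** The summands [alpha1], [alpha2] and [1] stand for the free evolution of the last sample, the
    held correction, and the disturbance since that sample. *)
Lemma sampled_error_bound (t : R) : 0 <= t <= t0 ->
  vnorm (xt t) <= b * alpha0 A B T * (alpha1 A T + alpha2 A T + 1).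
Proof.
move=> /andP[t_ge0 tt0].
have /truncn_itv : 0 <= t / T by rewrite divr_ge0// ltW.
set i := Num.truncn _; rewrite ler_pdivlMr// ltr_pdivrMr// => /andP[it ti].
have a0 : 0 <= i%:R * T by rewrite mulr_ge0// ltW.
have d0 : 0 <= t - i%:R * T by rewrite subr_ge0.
have dT : t - i%:R * T <= T by rewrite lerBlDl -{2}(mul1r T) -mulrDl natr1 ltW.
set xi := xt (i%:R * T).
have xib : vnorm xi <= b * alpha0 A B T by apply: sampled_point_bound; exact: le_trans tt0.
have hi s : i%:R * T <= s < t -> h s = - (N *m xi).
  by move=> /andP[is_ st]; apply: hE; rewrite is_ (lt_trans st).
have := @sampled_step _ _ _ _ B xt h f (N *m xi) _ _ b uA b0 a0 it xtA hi.
set E := expmx _; set zeta := invmx A *m _ => step.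
have {}step := step (fun s st => fb (introT andP
  (conj (proj1 (elimT andP st)) (le_trans (proj2 (elimT andP st)) tt0)))).
have e1 : vnorm (E *m xi) <= alpha1 A T * (b * alpha0 A B T).
  apply: le_trans (vnorm_mulmx _ _) _.
  apply: ler_pM.
  - exact: mnorm_ge0.
  - exact: vnorm_ge0.
  - exact: alpha1_ge.
  - exact: xib.
have al2 : 0 <= alpha2 A T.
  apply: le_trans (alpha2_ge (lexx 0) (ltW T0)).
  by apply: Rintegral_ge0 => s _; exact: mnorm_ge0.
have e2 : vnorm (E *m zeta - zeta) <= alpha2 A T * (b * alpha0 A B T).
  apply: (le_trans (expmx_increment_bound xi d0 dT)).
  exact: (ler_wpM2l al2 xib).
have e3 := le_trans step (ler_wpM2l b0 (alpha0_ge d0 dT)).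
rewrite -[xt t](subrK (E *m xi - (E *m zeta - zeta))).
apply: le_trans (vnormD _ _) _; apply: le_trans (lerD e3 (vnormB _ _)) _.
move: (vnorm (E *m xi)) (vnorm (E *m zeta - zeta)) e1 e2 => u v e1 e2.
rewrite mulrDr mulr1 addrC lerD2r mulrC mulrDl.
exact: (lerD e1 e2).
Qed.

End SampledErrorBound.

(** * The adaptive loop *)

Section Signals.
Variable R : realType.
Local Notation mu := (@lebesgue_measure R).

Lemma measurable_fun_finite (l : seq R) (g : R -> R) : measurable_fun [set` l] g.
Proof.
move=> _ Y mY; apply: countable_measurable => [t|]; first exact: measurable_set1.
by apply: finite_set_countable; apply: sub_finite_set (finite_seq l) => t [].
Qed.

(** Off a finite set [v] is continuous on an open set, hence measurable, and the finite set does not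
    affect measurability; boundedness gives integrability. *)
Lemma pw_continuous_locint k (v : R -> 'cV[R]_k) : bounded_sig v -> pw_continuous v ->
  locint v.
Proof.
move=> [M vM] pv; apply/locintP => i t t0.
have T0 : 0 < t + 1 by rewrite ltr_wpDl.
have [l [cv _]] := pv _ T0.
pose D : set R := `]0, t + 1[ `&` ~` [set` l].
have oD : open D.
  apply: openI; first exact: interval_open.
  rewrite openC; have /accessible_finite_set_closed := hausdorff_accessible (@Rhausdorff R).
  by apply; exact: finite_seq.
have mD : measurable_fun D (fun s => v s i 0).
  apply: open_continuous_measurable_fun => // s; rewrite inE => -[/= + sl].
  rewrite in_itv/= => /andP[s0 sT].
  have cs : {for s, continuous v} by apply: cv; [rewrite s0 ltW|exact/negP].
  apply: (@continuous_comp _ _ _ v (fun M : 'cV[R]_k => M i 0)) => //.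
  exact: coord_continuous.
have mU : measurable_fun (D `|` [set` 0 :: l]) (fun s => v s i 0).
  apply/measurable_funU; [exact: open_measurable| |].
    apply: countable_measurable => [s|]; first exact: measurable_set1.
    exact/finite_set_countable/finite_seq.
  by split=> //; exact: measurable_fun_finite.
apply: measurable_bounded_integrable => //.
- by rewrite /= lebesgue_measure_itv/= lte_fin; case: ifP; rewrite ?ltry.
- apply: measurable_funS mU.
    apply: measurableU; first exact: open_measurable.
    apply: countable_measurable => [s|]; first exact: measurable_set1.
    exact/finite_set_countable/finite_seq.
  move=> s /=; rewrite in_itv/= => /andP[s0 st].
  have [sl|sl] := boolP (s \in 0 :: l); first by right.
  left; move: sl; rewrite inE negb_or => /andP[sn0 sl]; split=> /=.
    by rewrite in_itv/= lt_def sn0 s0 (le_lt_trans st)// ltrDl.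
  exact/negP.
- exists M; split; rewrite ?num_real// => M' MM' s /=; rewrite in_itv/= => /andP[s0 _].
  by rewrite (le_trans (vnorm_coord _ _))// (le_trans (vM s s0))// ltW.
Qed.

Lemma vnorm_Linf k (v : R -> 'cV[R]_k) t : bounded_sig v -> 0 <= t ->
  vnorm (v t) <= Linf v.
Proof.
move=> [M vM] t0; rewrite /Linf; set S := [set _ | _ in _].
have tS : ((vnorm (v t))%:E <= ereal_sup S)%E.
  by apply: ereal_sup_ubound; exists t.
have Sle : (ereal_sup S <= M%:E)%E.
  by apply: ge_ereal_sup => _ [s /= s0 <-]; rewrite lee_fin vM.
rewrite -lee_fin fineK// fin_numElt (lt_le_trans _ tS) ?ltNyr//.
by rewrite (le_lt_trans Sle) ?ltry.
Qed.

(** Compactness keeps the supremum finite, so that [fine] returns it. *)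
Lemma vnorm_compact_sup k (X : set 'cV[R]_k) x0 : compact X -> X x0 ->
  vnorm x0 <= fine (ereal_sup [set (vnorm z)%:E | z in X]).
Proof.
move=> cX Xx0; set S := [set _ | _ in _].
have /choice[M MP] i : exists M : R, forall z, X z -> `|z i 0| <= M.
  have /compact_bounded[M [_ HM]] : compact ((fun z : 'cV[R]_k => z i 0) @` X).
    by apply: continuous_compact => //; apply: continuous_subspaceT; exact: coord_continuous.
  by exists (M + 1) => z Xz; apply: (HM (M + 1)); [rewrite ltrDl|exists z].
have tS : ((vnorm x0)%:E <= ereal_sup S)%E.
  by apply: ereal_sup_ubound; exists x0.
have Sle : (ereal_sup S <= (\sum_i M i)%:E)%E.
  apply: ge_ereal_sup => _ [z /= Xz <-]; rewrite lee_fin.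
  by apply: le_trans (vnorm_le_sum _) _; apply: ler_sum => i _; exact: MP.
rewrite -lee_fin fineK// fin_numElt (lt_le_trans _ tS) ?ltNyr//.
by rewrite (le_lt_trans Sle) ?ltry.
Qed.

Lemma max0_continuous : continuous (fun t : R => Num.max 0 t).
Proof.
move=> t; apply: (@continuous_max _ _ (fun=> 0) id t).
  exact: cst_continuous.
exact: cvg_id.
Qed.

(** The joint estimate in state and time makes [f] continuous along the continuous curve [y]. *)
Lemma lipschitz_comp_locint n m (f : R -> 'cV[R]_n -> 'cV[R]_m) (Z : set 'cV[R]_n) L x0
    (F y : R -> 'cV[R]_n) : f_lip f Z L -> ivp_sol x0 F y ->
  (forall t, 0 <= t -> Z (y t)) -> locint (fun t => f t (y t)).
Proof.
move=> [l fL] yF yr; apply/locintP => j.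
pose p (t : R) := Num.max 0 t.
have p0 t : 0 <= p t by rewrite /p le_max lexx.
suff cH : continuous (fun t => f (p t) (y (p t)) j 0).
  by apply: eq_locint1 (continuous_locint1 cH) => t t0; rewrite /p max_r.
move=> t.
(* Absolute values are taken because the signs of [L] and [l] are unknown. *)
pose G s := `|L| * (\sum_i `|y (p t) i 0 - y (p s) i 0|) + `|l| * `|p t - p s|.
have G0 : G s @[s --> t] --> 0.
  have -> : 0 = `|L| * (\sum_(i < n) `|y (p t) i 0 - y (p t) i 0|) + `|l| * `|p t - p t|.
    by rewrite subrr normr0 mulr0 addr0 big1 ?mulr0// => i _; rewrite subrr normr0.
  apply: cvgD; apply: cvgM; try exact: cvg_cst.
    apply: cvg_sumr => i; apply: cvg_norm; apply: cvgB; first exact: cvg_cst.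
    exact: (primitive_continuous (ivp_coord i yF)).
  by apply: cvg_norm; apply: cvgB; [exact: cvg_cst|exact: max0_continuous].
apply/cvgrPdist_le => e e0; move/cvgrPdist_le/(_ e e0): G0; apply: filterS => s.
rewrite sub0r normrN => /(le_trans (ler_norm _)); apply: le_trans.
apply: le_trans (fL j _ _ _ _ (p0 t) (p0 s) (yr _ (p0 t)) (yr _ (p0 s))) _.
rewrite /G lerD// ?ler_wpM2r ?ler_norm//.
apply: le_trans (ler_wpM2r (vnorm_ge0 _) (ler_norm L)) _; rewrite ler_wpM2l//.
apply: le_trans (vnorm_le_sum _) _; apply: ler_sum => i _.
by rewrite !mxE.
Qed.

Lemma ivp_vnorm_continuous k x0 (F x : R -> 'cV[R]_k) : ivp_sol x0 F x ->
  continuous (fun t : R => vnorm (x (Num.max 0 t))).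
Proof.
move=> xF; apply: continuous_bigmax => i t; apply: cvg_norm.
exact: (primitive_continuous (ivp_coord i xF)).
Qed.

(** At the supremum [t0] of the times up to which the bound holds, continuity gives the bound,
    [strict] makes it strict, and continuity again carries it past [t0]. *)
Lemma continuity_bound (phi : R -> R) (rho : R) : continuous phi -> phi 0 <= rho ->
  (forall t, 0 <= t -> (forall s, 0 <= s <= t -> phi s <= rho) -> phi t < rho) ->
  forall t, 0 <= t -> phi t <= rho.
Proof.
move=> cphi phi0 strict t1 t10; rewrite leNgt; apply/negP => phit1.
pose S := [set s : R | 0 <= s /\ forall r, 0 <= r <= s -> phi r <= rho].
have S0 : S 0 by split=> // r /andP[r0 r0']; have -> : r = 0 by apply/eqP; rewrite eq_le r0'.
have Sub : ubound S t1.
  move=> s [s0 sP]; rewrite leNgt; apply/negP => t1s.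
  by move: phit1; rewrite ltNge sP// t10 ltW.
have hS : has_sup S by split; [exists 0|exists t1].
have t00 : 0 <= sup S by apply: ub_le_sup => //; exists t1.
set t0 := sup S in t00.
have below r : 0 <= r -> r < t0 -> phi r <= rho.
  move=> r0 rt0; have [|s [s0 sP]] := @sup_adherent _ S (t0 - r) _ hS.
    by rewrite subr_gt0.
  by rewrite -/t0 subKr => rs; apply: sP; rewrite r0 ltW.
have at0 : phi t0 <= rho.
  move: t00; rewrite le_eqVlt => /predU1P[<-//|t0p].
  rewrite leNgt; apply/negP => phit0.
  have : \forall r \near t0, rho < phi r by exact: (@cvgr_gt _ _ _ _ _ _ (cphi t0)).
  move=> /nbhs_ballP[e /= e0 He].
  pose r := Num.max (t0 / 2) (t0 - e / 2).
  have rt0 : r < t0 by rewrite gt_max; apply/andP; split; lra.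
  have r0 : 0 <= r by rewrite le_max; apply/orP; left; lra.
  have : rho < phi r.
    apply: He; rewrite /ball/= gtr0_norm ?subr_gt0//.
    have : t0 - e / 2 <= r by rewrite le_max lexx orbT.
    lra.
  by rewrite ltNge below.
have t0S : S t0.
  split=> // r /andP[r0]; rewrite le_eqVlt => /predU1P[->//|]; exact: below.
have : \forall r \near t0, phi r < rho.
  by apply: (@cvgr_lt _ _ _ _ _ _ (cphi t0)); exact: strict _ t00 (proj2 t0S).
move=> /nbhs_ballP[e /= e0 He].
have : S (t0 + e / 2).
  split; first by apply: addr_ge0 => //; lra.
  move=> r /andP[r0 rt]; case: (leP r t0) => rt0; first by apply: (proj2 t0S); rewrite r0.
  apply/ltW/He; rewrite /ball/= ltr0_norm; lra.
have ubS : has_ubound S by exists t1.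
by move=> /(ub_le_sup ubS); rewrite -/t0; lra.
Qed.

End Signals.

(** * The pseudo-inverse of [B] *)

Section PseudoInverse.
Variables (R : realType) (m p : nat) (B : 'M[R]_(m + p, m)) (Bperp : 'M[R]_(m + p, p)).
Hypotheses (BP : trmx Bperp *m B = 0) (uB : row_mx B Bperp \in unitmx).

Lemma mulmx_tr_eq0 k (w : 'cV[R]_k) : w^T *m w = 0 -> w = 0.
Proof.
move=> /matrixP/(_ 0 0); rewrite !mxE => /eqP; rewrite psumr_eq0; last first.
  by move=> i _; rewrite mxE -expr2 sqr_ge0.
move=> /allP w0; apply/colP => i; rewrite mxE.
have := w0 i (mem_index_enum i); rewrite mxE -expr2 sqrf_eq0 => /eqP //.
Qed.

(** Invertibility of [row_mx B Bperp] makes [B] injective, hence [B^T B] invertible. *)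
Lemma mppinv_mulmx : mppinv B *m B = 1%:M.
Proof.
rewrite /mppinv -mulmxA mulVmx//; apply: mulmx_inj_unit => v Bv.
have Bv0 : B *m v = 0 by apply: mulmx_tr_eq0; rewrite trmx_mul -mulmxA (mulmxA B^T) Bv mulmx0.
have : row_mx B Bperp *m col_mx v 0 = 0 by rewrite mul_row_col Bv0 mulmx0 addr0.
move/(congr1 (mulmx (invmx (row_mx B Bperp)))); rewrite mulKmx// mulmx0 => /eqP.
by rewrite col_mx_eq0 => /andP[/eqP].
Qed.

Lemma mppinv_perp : mppinv B *m Bperp = 0.
Proof.
rewrite /mppinv -mulmxA (_ : B^T *m Bperp = 0) ?mulmx0//.
by apply: trmx_inj; rewrite trmx_mul trmxK BP trmx0.
Qed.

End PseudoInverse.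

(** * Comparison of the closed loop with the Picard iterates *)

Section AdaptiveLoop.
Variables (R : realType) (m p : nat).
Local Notation n := (m + p)%N.
Variables (Am : 'M[R]_n) (B Bv : 'M[R]_(n, m)) (Ae : 'M[R]_n) (Bperp : 'M[R]_(n, p))
  (kf : 'I_m -> R) (T : R) (v : R -> 'cV[R]_m) (X0 : set 'cV[R]_n) (x0 : 'cV[R]_n)
  (f : R -> 'cV[R]_n -> 'cV[R]_m) (rho_r gamma1 L_rho b_rhor b_rho : R)
  (x xn xhat : R -> 'cV[R]_n) (ua : R -> 'cV[R]_m) (sigma : R -> 'cV[R]_n).
Hypotheses (hAm : hurwitz Am) (hAe : hurwitz Ae)
  (BP : trmx Bperp *m B = 0) (uB : row_mx B Bperp \in unitmx)
  (kf0 : forall j, 0 < kf j) (T0 : 0 < T)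
  (bv : bounded_sig v) (pv : pw_continuous v) (cX0 : compact X0) (X0x0 : X0 x0)
  (gamma10 : 0 < gamma1).
Local Notation rho := (rho_r + gamma1).
Hypotheses (fL : f_lip f (Omega rho) L_rho) (fbr : f_bnd f (Omega rho_r) b_rhor)
  (fb : f_bnd f (Omega rho) b_rho).
Hypotheses (L0 : 0 <= L_rho) (br0 : 0 <= b_rhor) (b0 : 0 <= b_rho).

Let N := mppinv B.
Let C := Cfilt kf.
Let K := filter_gain kf.
Let G := Gtf kf Am B.
Let E := Etf kf Am Ae B N.
Let P := Ptf kf Ae N.
Let rho_in := L1norm (sF R *: resolvent Am) * fine (ereal_sup [set (vnorm z)%:E | z in X0]).
Let gamma0 := b_rho * alpha0 Ae B T * (alpha1 Ae T + alpha2 Ae T + 1).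
Let q := L1norm G * L_rho.

Hypotheses
  (C1 : L1norm G * b_rhor < rho_r - L1norm (resolvent Am *m mxF Bv) * Linf v - rho_in)
  (C2 : q < 1) (C3 : L1norm E / (1 - q) * gamma0 < gamma1).
Hypotheses (xnA : ivp_sol x0 (fun t => Am *m xn t + Bv *m v t) xn)
  (xA : ivp_sol x0 (fun t => Am *m x t + Bv *m v t + B *m (ua t + f t (x t))) x)
  (xhatA : ivp_sol x0 (fun t => Am *m x t + Bv *m v t + B *m (ua t + usubmx (sigma t))
                       + Bperp *m dsubmx (sigma t) + Ae *m (xhat t - x t)) xhat)
  (sigmaE : forall (i : nat) (t : R), i%:R * T <= t < i.+1%:R * T ->
     sigma t = - (invmx (row_mx B Bperp) *m invmx (PhiT Ae T) *m expmx (T *: Ae)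
                  *m (xhat (i%:R * T) - x (i%:R * T))))
  (uaE : zs_output (- C) (fun t => usubmx (sigma t)) ua).

Let xt t := xhat t - x t.
Let fx t := f t (x t).
Let h t := row_mx B Bperp *m sigma t.

Let hBE t : h t = B *m usubmx (sigma t) + Bperp *m dsubmx (sigma t).
Proof. by rewrite /h -{1}(vsubmxK (sigma t)) mul_row_col. Qed.

Let xtA : ivp_sol 0 (fun t => Ae *m xt t + h t - B *m fx t) xt.
Proof.
have := ivpB xhatA xA; rewrite subrr; apply: eq_ivp => // t t0.
rewrite hBE /fx /xt !mulmxDr; move: (Am *m x t) (Bv *m v t) (B *m ua t) => a b c.
move: (B *m usubmx _) (Bperp *m _) (B *m f _ _) (Ae *m xhat t) (Ae *m - x t) => d e g i j.
by apply/colP => l; rewrite !mxE; ring.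
Qed.

(** The equations give integrability only of whole right-hand sides. Subtracting the nominal one
    removes [Bv v], [mppinv B] undoes [B], and [ua] is integrable as a filter output. *)
Let fx_locint : locint fx.
Proof.
have iua := filterN_locint uaE.
have [ixA _] := xA; have [ixnA _] := xnA.
have i1 := locintB ixA (locint_mulmx Am (ivp_locint xA)).
have i2 := locintB ixnA (locint_mulmx Am (ivp_locint xnA)).
have i3 := locintB (locint_mulmx N (locintB i1 i2)) iua.
apply: eq_locint i3 => t t0; rewrite /fx.
transitivity (N *m (B *m (ua t + f t (x t))) - ua t); last first.
  by rewrite mulmxA (mppinv_mulmx uB) mul1mx addrC addKr.
congr (N *m _ - _); move: (Am *m x t) (Bv *m v t) (B *m _) (Am *m xn t) => a b c d.
by apply/colP => l; rewrite !mxE; ring.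
Qed.

(** [w1] is the filtered [f], and [w2] the filtered [sigma1 - f] written in terms of [xt]: since
    [N xt' = N Ae xt + sigma1 - f], the term [K N xt] supplies [K (sigma1 - f)] and [Pgain]
    compensates the rest. *)
Let adaptive_decomposition : exists (e1 e2 : R -> 'cV[R]_n) (w1 w2 : R -> 'cV[R]_m),
  [/\ zs_output G fx e1, zs_output E xt e2, zs_output C fx w1, zs_output P xt w2 &
      forall t, 0 <= t -> x t - xn t = e1 t - e2 t /\ ua t = - (w1 t + w2 t)].
Proof.
have [w1 w1A] := linear_ivp_exists (- K) (locint_mulmx K fx_locint).
have [q2 q2A] := linear_ivp_exists (- K) (locint_mulmx (Pgain kf Ae N) (ivp_locint xtA)).
pose w2 t := q2 t + K *m N *m xt t.
have wA : ivp_sol 0 (fun t => - K *m (w1 t + w2 t) + K *m usubmx (sigma t))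
    (fun t => w1 t + w2 t).
  have := ivpD w1A (ivpD q2A (ivp_mulmx (K *m N) xtA)).
  rewrite mulmx0 !addr0; apply: eq_ivp => // t t0.
  have NB : N *m (h t - B *m fx t) = usubmx (sigma t) - fx t.
    rewrite hBE mulmxBr mulmxDr !mulmxA (mppinv_mulmx uB) (mppinv_perp BP) !mul1mx mul0mx.
    by rewrite addr0.
  have E1 : Pgain kf Ae N *m xt t = - (K *m (K *m (N *m xt t) + N *m (Ae *m xt t))).
    by rewrite /Pgain mulNmx -mulmxA mulmxDl -!mulmxA.
  have E2 : K *m N *m (Ae *m xt t + h t - B *m fx t) =
      K *m (N *m (Ae *m xt t) + (usubmx (sigma t) - fx t)).
    by rewrite -(mulmxA K N) -addrA (mulmxDr N) NB.
  rewrite E1 E2 /w2 -(mulmxA K N).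
  move: (N *m xt t) (N *m (Ae *m xt t)) (usubmx (sigma t)) => y y' s.
  rewrite !(mulmxDr, mulNmx, mulmxN).
  move: (K *m w1 t) (K *m fx t) (K *m q2 t) (K *m (K *m y)) (K *m y') (K *m s).
  by move=> c1 c2 c3 c4 c5 c6; apply/colP => l; rewrite !mxE; ring.
have uaw t : 0 <= t -> ua t = - (w1 t + w2 t).
  by move=> t0; exact: (zs_output_causal uaE (filterN_output wA) t0).
have [e1 e1A] := linear_ivp_exists Am
  (locint_mulmx B (locintB fx_locint (ivp_locint w1A))).
have eA := ivpB xA xnA; have e2A := ivpB e1A eA.
(* [e2] is chosen to make the decomposition hold; the content is that it is the output of [E] driven
   by [xt]. *)
exists e1, (fun t => e1 t - (x t - xn t)), w1, w2; split.
- exact: Gtf_output w1A e1A.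
- apply: (Etf_output q2A); move: e2A; rewrite !subrr; apply: eq_ivp => // t t0.
  rewrite uaw// /w2 -/(fx t) !(mulmxDr, mulmxN).
  move: (Am *m e1 t) (Am *m x t) (Am *m xn t) (B *m fx t) (B *m w1 t) (B *m q2 t).
  move: (B *m (K *m N *m xt t)) (Bv *m v t) => c1 c2 c3 c4 c5 c6 c7 c8.
  by apply/colP => l; rewrite !mxE; ring.
- exact: filter_output w1A.
- exact: Ptf_output q2A.
- by move=> t t0; split; [rewrite subKr|exact: uaw].
Qed.

(** Subtracting the free response [e^(tAm) x0], which accounts for [rho_in], leaves a zero-state
    response to [v]. *)
Let nominal_bound t : 0 <= t ->
  vnorm (xn t) <= L1norm (resolvent Am *m mxF Bv) * Linf v + rho_in.
Proof.
move=> t0.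
have xIA : ivp_sol x0 (fun t => Am *m (expmx (t *: Am) *m x0))
    (fun t => expmx (t *: Am) *m x0).
  by apply: eq_ivp (ivp_expmx Am (ivp_cst x0)) => // s s0; rewrite mulmx0 addr0.
set xI := (fun t => expmx (t *: Am) *m x0) in xIA.
have xvA : ivp_sol 0 (fun t => Am *m (xn t - xI t) + Bv *m v t) (fun t => xn t - xI t).
  have := ivpB xnA xIA; rewrite subrr; apply: eq_ivp => // s s0.
  by rewrite mulmxBr addrAC.
rewrite -(subrK (xI t) (xn t)); apply: le_trans (vnormD _ _) _; apply: lerD.
  apply: (L1norm_bound (resolvent_bibo hAm Bv) (resolvent_output xvA)) => //.
    exact: pw_continuous_locint.
  by move=> s /andP[s0 _]; exact: vnorm_Linf.
apply: (L1norm_bound (sresolvent_bibo hAm) (sresolvent_output xIA)) => //.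
  exact: ivp_locint (ivp_cst x0).
by move=> s _; exact: vnorm_compact_sup.
Qed.

Let LG0 : 0 <= L1norm G. Proof. exact: L1norm_ge0. Qed.
Let q0 : 0 <= q. Proof. exact: mulr_ge0. Qed.

Let nominal_lt t : 0 <= t -> vnorm (xn t) + L1norm G * b_rhor < rho_r.
Proof.
move=> /nominal_bound; move: (vnorm (xn t)) => a; move: C1.
move: (L1norm G * b_rhor) (L1norm _ * Linf v) rho_in => c d e; lra.
Qed.

Let f_bounded r b (y : 'cV[R]_n) t : 0 <= b -> f_bnd f (Omega r) b -> 0 <= t ->
  vnorm y <= r -> vnorm (f t y) <= b.
Proof. by move=> bb fr t0 yr; apply/vnorm_leP; split=> // j; exact: fr. Qed.

Let f_lipschitz (y z : 'cV[R]_n) t : 0 <= t -> vnorm y <= rho -> vnorm z <= rho ->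
  vnorm (f t y - f t z) <= L_rho * vnorm (y - z).
Proof.
move=> t0 yr zr; apply/vnorm_leP; split=> [|j]; first by rewrite mulr_ge0 ?vnorm_ge0.
have [l fl] := fL; have := fl j y z t t t0 t0 yr zr.
rewrite subrr normr0 mulr0 addr0; suff -> : (f t y - f t z) j 0 = f t y j 0 - f t z j 0.
  by [].
by rewrite !mxE.
Qed.

Section OnInterval.
Variable t0 : R.
Hypothesis xrho : forall s, 0 <= s <= t0 -> vnorm (x s) <= rho.

Let delta := L1norm E * gamma0.

Let xt_bound s : 0 <= s <= t0 -> vnorm (xt s) <= gamma0.
Proof.
apply: (sampled_error_bound hAe T0 b0 xtA) => [i r ir|r /andP[r0 rt]].
  by rewrite /h (sigmaE ir) mulmxN -!mulmxA mulKVmx.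
by apply: f_bounded fb _ _ => //; apply: xrho; rewrite r0.
Qed.

(* The Picard iterates of the reference system [y = xn + G f(y)]. *)
Let reference_iterate k : exists (F y : R -> 'cV[R]_n),
  [/\ ivp_sol x0 F y, forall t, 0 <= t -> vnorm (y t) <= rho_r,
      forall t, 0 <= t -> vnorm (y t - xn t) <= L1norm G * b_rhor &
      forall t, 0 <= t <= t0 ->
        vnorm (x t - y t) <= q ^+ k * (2 * rho) + delta / (1 - q)].
Proof.
have [e1 [e2 [w1 [w2 [e1G e2E _ _ dec]]]]] := adaptive_decomposition.
have gamma00 t : 0 <= t <= t0 -> 0 <= gamma0.
  by move=> /xt_bound; apply: le_trans; exact: vnorm_ge0.
have q1 : 0 < 1 - q by rewrite subr_gt0.
elim: k => [|k [F [y [yF yr yn xy]]]].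
  (* The iteration starts at [xn]; both [x] and [xn] lie in [Omega rho] on [[0, t0]], whence the
     factor [2 * rho]. *)
  exists (fun t => Am *m xn t + Bv *m v t), xn; split=> // t tt.
  - have := nominal_lt tt; have : 0 <= L1norm G * b_rhor by exact: mulr_ge0.
    by move: (L1norm G * b_rhor) => a; lra.
  - by rewrite subrr vnorm0 mulr_ge0.
  - have t_ge0 : 0 <= t by case/andP: tt.
    have d0 : 0 <= delta / (1 - q).
      apply: divr_ge0; last exact: ltW.
      by apply: mulr_ge0; [exact: L1norm_ge0|exact: gamma00 tt].
    have xb := xrho tt; have := nominal_lt t_ge0.
    have LGb : 0 <= L1norm G * b_rhor by exact: mulr_ge0.
    have := vnormB (x t) (xn t); rewrite expr0 mul1r.
    move: (L1norm G * b_rhor) LGb => a a0; move: (delta / _) d0 => d d0.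
    move: (vnorm (x t)) xb (vnorm (xn t)) (vnorm (_ - _)) => c1 c1r c2 c3.
    by have := gamma10; lra.
have iy : locint (fun t => f t (y t)).
  apply: lipschitz_comp_locint fL yF _ => t tt; rewrite /Omega/=.
  by apply: le_trans (yr t tt) _; rewrite lerDl ltW.
have [wy wyA] := linear_ivp_exists (- K) (locint_mulmx K iy).
have [ey eyA] := linear_ivp_exists Am (locint_mulmx B (locintB iy (ivp_locint wyA))).
have eyG : zs_output G (fun t => f t (y t)) ey by exact: Gtf_output wyA eyA.
have eyb t : 0 <= t -> vnorm (ey t) <= L1norm G * b_rhor.
  move=> tt; apply: (L1norm_bound (Gtf_bibo B kf0 hAm) eyG) => // s /andP[s0 _].
  by apply: f_bounded fbr _ _ => //; exact: yr.
exists (fun t => Am *m xn t + Bv *m v t + (Am *m ey t + B *m (f t (y t) - wy t))),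
  (fun t => xn t + ey t); split.
- by have := ivpD xnA eyA; rewrite addr0.
- move=> t tt; apply: le_trans (vnormD _ _) _; apply: ltW.
  by apply: le_lt_trans (nominal_lt tt); rewrite lerD2l; exact: eyb.
- by move=> t tt; rewrite addrC addKr; exact: eyb.
move=> t /andP[t_ge0 tt0].
have -> : x t - (xn t + ey t) = (e1 t - ey t) - e2 t.
  by rewrite opprD addrA (proj1 (dec t t_ge0)) addrAC.
have D := zs_outputB iy e1G eyG.
pose d := q ^+ k * (2 * rho) + delta / (1 - q).
have b1 : vnorm (e1 t - ey t) <= L1norm G * (L_rho * d).
  apply: (L1norm_bound (Gtf_bibo B kf0 hAm) D) => //.
    exact: locintB.
  move=> s /andP[s0 st]; have st0 : 0 <= s <= t0 by rewrite s0 (le_trans st).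
  apply: le_trans (f_lipschitz s0 (xrho st0) _) _.
    by apply: le_trans (yr s s0) _; rewrite lerDl ltW.
  by apply: ler_wpM2l => //; exact: xy.
have b2 : vnorm (e2 t) <= delta.
  apply: (L1norm_bound (Etf_bibo Ae B N kf0 hAm) e2E) => //; first exact: ivp_locint xtA.
  by move=> s /andP[s0 st]; apply: xt_bound; rewrite s0 (le_trans st).
apply: le_trans (vnormB _ _) _; apply: le_trans (lerD b1 b2) _.
(* [delta / (1 - q)] is the fixed point of [d -> q d + delta], so only the geometric term
   changes. *)
rewrite mulrA -/q /d mulrDr exprS mulrA -addrA lerD2l le_eqVlt; apply/orP; left.
by apply/eqP; field; rewrite gt_eqF.
Qed.

Let close_iterate : 0 <= t0 -> exists (F y : R -> 'cV[R]_n),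
  [/\ ivp_sol x0 F y, forall t, 0 <= t -> vnorm (y t) <= rho_r,
      forall t, 0 <= t -> vnorm (y t - xn t) <= L1norm G * b_rhor &
      forall t, 0 <= t <= t0 -> vnorm (x t - y t) < gamma1].
Proof.
move=> t00.
have e0 : 0 < gamma1 - delta / (1 - q) by rewrite subr_gt0 /delta mulrAC.
have cv : q ^+ k * (2 * rho) @[k --> \oo] --> 0 * (2 * rho).
  by apply: cvgM; [apply: cvg_expr; rewrite ger0_norm|exact: cvg_cst].
rewrite mul0r in cv.
have : \forall k \near \oo, q ^+ k * (2 * rho) < gamma1 - delta / (1 - q).
  exact: (@cvgr_lt _ _ _ _ _ _ cv).
move=> /filter_ex[k kP]; have [F [y [yF yr yn xy]]] := reference_iterate k.
exists F, y; split=> // t tt; apply: le_lt_trans (xy t tt) _.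
by rewrite -ltrBrDr.
Qed.

(** Passing through an iterate is what yields the constant [b_rhor]: the iterate lies in
    [Omega rho_r], whereas [x] is only known to lie in [Omega rho]. The gap to [x] costs [gamma1] in
    the state and, through the Lipschitz constant, [L_rho * gamma1] before the filter. *)
Lemma adaptive_bounds_on_interval : 0 <= t0 ->
  [/\ vnorm (x t0) < rho, vnorm (x t0 - xn t0) <= L1norm G * b_rhor + gamma1 &
      vnorm (ua t0) <= L1norm C * b_rhor + (L1norm C * L_rho * gamma1 + L1norm P * gamma0)].
Proof.
move=> t00; have [F [y [yF yr yn xy]]] := close_iterate t00.
have tt : 0 <= t0 <= t0 by rewrite t00 lexx.
have xyt := xy t0 tt.
have [e1 [e2 [w1 [w2 [_ _ w1C w2P dec]]]]] := adaptive_decomposition.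
split.
- rewrite -(subrK (y t0) (x t0)); apply: le_lt_trans (vnormD _ _) _.
  by rewrite addrC; exact: ler_ltD (yr t0 t00) xyt.
- rewrite -(subrKA (y t0)) addrC; apply: le_trans (vnormD _ _) _.
  by rewrite addrC addrC; apply: lerD; [exact: yn|exact: ltW].
have iy : locint (fun t => f t (y t)).
  apply: lipschitz_comp_locint fL yF _ => t t_ge0; rewrite /Omega/=.
  by apply: le_trans (yr t t_ge0) _; rewrite lerDl ltW.
have [wy wyA] := linear_ivp_exists (- K) (locint_mulmx K iy).
have wyC := filter_output wyA.
have b1 : vnorm (wy t0) <= L1norm C * b_rhor.
  apply: (L1norm_bound (filter_bibo kf0) wyC) => // s /andP[s0 _].
  by apply: f_bounded fbr _ _ => //; exact: yr.
have b2 : vnorm (w1 t0 - wy t0) <= L1norm C * (L_rho * gamma1).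
  apply: (L1norm_bound (filter_bibo kf0) (zs_outputB iy w1C wyC)) => //.
    exact: locintB.
  move=> s st0; have /andP[s0 st] := st0.
  apply: le_trans (f_lipschitz s0 (xrho st0) _) _.
    by apply: le_trans (yr s s0) _; rewrite lerDl ltW.
  by apply: ler_wpM2l => //; exact/ltW/xy.
have b3 : vnorm (w2 t0) <= L1norm P * gamma0.
  apply: (L1norm_bound (Ptf_bibo Ae N kf0) w2P) => //; exact: ivp_locint xtA.
rewrite (proj2 (dec t0 t00)) vnormN -(subrK (wy t0) (w1 t0)).
apply: le_trans (vnormD _ _) _; rewrite addrA; apply: lerD => //.
apply: le_trans (vnormD _ _) _; rewrite addrC; apply: lerD => //.
by rewrite -mulrA.
Qed.

End OnInterval.

Lemma adaptive_bounds t : 0 <= t ->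
  vnorm (x t - xn t) <= L1norm G * b_rhor + gamma1 /\
  vnorm (ua t) <= L1norm C * b_rhor + (L1norm C * L_rho * gamma1 + L1norm P * gamma0).
Proof.
have xmax (s : R) : 0 <= s -> Num.max 0 s = s by exact: max_r.
have xrho s : 0 <= s -> vnorm (x s) <= rho.
  move=> s0; rewrite -(xmax _ s0); move: s s0.
  apply: (continuity_bound (ivp_vnorm_continuous xA)) => [|s s0 xs].
    rewrite maxxx (ivp_at0 xA) -(ivp_at0 xnA).
    have := nominal_lt (lexx 0); have : 0 <= L1norm G * b_rhor by exact: mulr_ge0.
    by move: (L1norm G * b_rhor) (vnorm _) => a c; have := gamma10; lra.
  rewrite xmax//; have [] // := @adaptive_bounds_on_interval s.
  by move=> r rs; have := xs r rs; rewrite xmax//; case/andP: rs.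
move=> t0; have [] // := @adaptive_bounds_on_interval t.
by move=> s /andP[s0 _]; exact: xrho.
Qed.

End AdaptiveLoop.

(** * The degenerate case of no input channels *)

Section EmptyInput.
Variables (R : realType) (m : nat).
Hypothesis m0 : m = 0%N.

Lemma mulmx_dim0 k r (M : 'M[R]_(k, m)) (w : 'M[R]_(m, r)) : M *m w = 0.
Proof. by move: M w; rewrite m0 => M w; rewrite (thinmx0 M) mul0mx. Qed.

Lemma vnorm_dim0 (w : 'cV[R]_m) : vnorm w = 0.
Proof. by move: w; rewrite m0 => w; rewrite (flatmx0 w) vnorm0. Qed.

Lemma L1norm_width0 k (H : 'M[tf R]_(k, m)) : L1norm H = 0.
Proof.
apply: L1norm_eq0 => u y t t0 _ [l [A [B [C [D [z [_ [zA yE]]]]]]]].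
rewrite yE// mulmx_dim0 addr0 (@ivp_homogeneous0 _ _ A z t) ?mulmx0//.
by apply: eq_ivp zA => // s s0; rewrite mulmx_dim0 addr0.
Qed.

Lemma L1norm_height0 k (H : 'M[tf R]_(m, k)) : L1norm H = 0.
Proof.
apply: L1norm_eq0 => u y t t0 _ _; apply: vnorm_eq0.
by rewrite vnorm_dim0.
Qed.

End EmptyInput.

Theorem theorem2 (R : realType) (m p : nat)
  (Am : 'M[R]_(m + p)) (B : 'M[R]_(m + p, m)) (Bv : 'M[R]_(m + p, m))
  (Ae : 'M[R]_(m + p)) (Bperp : 'M[R]_(m + p, p))
  (kf : 'I_m -> R) (T : R)
  (v : R -> 'cV[R]_m) (X0 : set 'cV[R]_(m + p)) (x0 : 'cV[R]_(m + p))
  (f : R -> 'cV[R]_(m + p) -> 'cV[R]_m)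
  (rho_r gamma1 L_rho b_rhor b_rho : R)
  (x xn xhat : R -> 'cV[R]_(m + p)) (ua : R -> 'cV[R]_m)
  (sigma : R -> 'cV[R]_(m + p)) :
  (* standing setup *)
  hurwitz Am -> \rank B = m -> hurwitz Ae ->
  trmx Bperp *m B = 0 -> row_mx B Bperp \in unitmx ->
  (forall j, 0 < kf j) -> 0 < T ->
  bounded_sig v -> pw_continuous v ->
  compact X0 -> X0 x0 ->
  (forall Z : set 'cV[R]_(m + p), compact Z ->
     exists L b : R, f_lip f Z L /\ f_bnd f Z b) ->
  (* constants of the theorem *)
  0 < rho_r -> 0 < gamma1 ->
  let rho := rho_r + gamma1 in
  f_lip f (Omega rho) L_rho ->
  f_bnd f (Omega rho_r) b_rhor ->
  f_bnd f (Omega rho) b_rho ->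
  let Hxm := resolvent Am *m mxF B in
  let Hxv := resolvent Am *m mxF Bv in
  let C := Cfilt kf in
  let Gxm := Hxm *m (1%:M - C) in
  let rho_in := L1norm (sF R *: resolvent Am) *
                fine (ereal_sup [set (vnorm z)%:E | z in X0]) in
  let gamma0 := b_rho * alpha0 Ae B T * (alpha1 Ae T + alpha2 Ae T + 1) in
  (* (C1) *)
  L1norm Gxm * b_rhor < rho_r - L1norm Hxv * Linf v - rho_in ->
  (* (C2) *)
  L1norm Gxm * L_rho < 1 ->
  (* (C3) *)
  L1norm (Hxm *m C *m mxF (mppinv B) *m ((sF R)%:M - mxF Ae)) /
    (1 - L1norm Gxm * L_rho) * gamma0 < gamma1 ->
  (* nominal system *)
  ivp_sol x0 (fun t => Am *m xn t + Bv *m v t) xn ->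
  (* adaptive closed-loop system *)
  ivp_sol x0 (fun t => Am *m x t + Bv *m v t + B *m (ua t + f t (x t))) x ->
  (* state predictor *)
  ivp_sol x0 (fun t => Am *m x t + Bv *m v t + B *m (ua t + usubmx (sigma t))
                       + Bperp *m dsubmx (sigma t) + Ae *m (xhat t - x t)) xhat ->
  (* piecewise-constant adaptive law *)
  (forall (i : nat) (t : R), i%:R * T <= t < i.+1%:R * T ->
     sigma t = - (invmx (row_mx B Bperp) *m invmx (PhiT Ae T) *m expmx (T *: Ae)
                  *m (xhat (i%:R * T) - x (i%:R * T)))) ->
  (* control law  u_a(s) = - C(s) sigma1_hat(s) *)
  zs_output (- C) (fun t => usubmx (sigma t)) ua ->
  let gamma2 := L1norm C * L_rho * gamma1 +
                L1norm (C *m mxF (mppinv B) *m ((sF R)%:M - mxF Ae)) * gamma0 in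
  forall t : R, 0 <= t ->
    vnorm (x t - xn t) <= L1norm Gxm * b_rhor + gamma1 /\
    vnorm (ua t) <= L1norm C * b_rhor + gamma2.
Proof.
move=> hAm _ hAe BP uB kf0 T0 bv pv cX0 X0x0 _ rho_r0 gamma10 rho fL fbr fb.
move=> Hxm Hxv C Gxm rho_in gamma0 C1 C2 C3 xnA xA xhatA sigmaE uaE gamma2 t t0.
(* Without input channels the componentwise bounds on [f] do not determine the signs of the
   constants, but [ua] and the norms multiplying those constants in the conclusion vanish, and
   [x - xn] solves a homogeneous equation. *)
have [m0|m0] := posnP m.
  split; last first.
    by rewrite /gamma2 vnorm_dim0// !L1norm_height0// !mul0r !addr0.
  rewrite L1norm_width0// mul0r add0r (@ivp_homogeneous0 _ _ Am (fun t => x t - xn t))//.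
    by rewrite vnorm0 ltW.
  have := ivpB xA xnA; rewrite subrr; apply: eq_ivp => // s s0.
  by rewrite (mulmx_dim0 m0 B) addr0 opprD addrACA subrr addr0 mulmxBr.
pose j := Ordinal m0.
have rho0 : 0 < rho by exact: addr_gt0.
have br0 : 0 <= b_rhor.
  apply: le_trans (normr_ge0 _) (fbr j 0 0 (lexx 0) _).
  by rewrite /Omega/= vnorm0 ltW.
have b0 : 0 <= b_rho.
  apply: le_trans (normr_ge0 _) (fb j 0 0 (lexx 0) _).
  by rewrite /Omega/= vnorm0 ltW.
have L0 : 0 <= L_rho.
  (* Comparing [f] at [c] and at [0] at the same time bounds an absolute value by [L_rho * vnorm c],
     which forces the sign of [L_rho]; the index [j] also witnesses that [c] is nonzero. *)
  have [l fl] := fL; pose c : 'cV[R]_(m + p) := const_mx rho.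
  have c_le : vnorm c <= rho.
    by apply/vnorm_leP; split=> [|i]; [exact: ltW|rewrite mxE gtr0_norm].
  have c_gt : 0 < vnorm c.
    apply: lt_le_trans (vnorm_coord c (lshift p j)); rewrite mxE gtr0_norm//.
  have := fl j c 0 0 0 (lexx 0) (lexx 0) c_le.
  rewrite subrr normr0 mulr0 addr0 subr0 => H.
  rewrite -(pmulr_lge0 _ c_gt); apply: le_trans (normr_ge0 _) (H _).
  by rewrite /Omega/= vnorm0 ltW.
exact (adaptive_bounds hAm hAe BP uB kf0 T0 bv pv cX0 X0x0 gamma10 fL fbr fb
  L0 br0 b0 C1 C2 C3 xnA xA xhatA sigmaE uaE t0).
Qed.
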